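(* Let $-1<q<1$. There exists a constant $A=A(|q|)>0$, depending only on $|q|$ (in particular independent of $d$), such that for every $d\in\mathbb{N}$, every $n\in\mathbb{N}$ and all complex coefficients $\{\alpha_w\}_{w\in[d]^*}$, the $q$-circular system $(c_1^{(q)},\ldots,c_d^{(q)})$ satisfies \[\left\|\sum_{|w|=n}\alpha_w c_w^{(q)}\right\|\le A\sqrt{n+1}\,\left\|\sum_{|w|=n}\alpha_w c_w^{(q)}\right\|_2 ,\] where the sums run over words $w\in[d]^*$ of length $n$.
   Context: Let $H=H_1\oplus H_2$ with $H_1=H_2=\mathbb{C}^d$, let $e_1,\ldots,e_d$ be an orthonormal basis of $H_1$ and $e_{\overline 1},\ldots,e_{\overline d}$ an orthonormal basis of $H_2$. Inner products are linear in the first variable. On the algebraic Fock space $\bigoplus_{n\ge0}H^{\otimes n}$ (algebraic direct sum, $H^{\otimes 0}=\mathbb{C}\Omega$ with $\Omega$ a unit vector) the $q$-inner product is, for $\xi\in H^{\otimes m},\eta\in H^{\otimes n}$, $\langle \xi,\eta\rangle_q=\delta_{m,n}\langle P^{(m)}\xi,\eta\rangle_{H^{\otimes m}}$, where $P^{(m)}(\xi_1\otimes\cdots\otimes\xi_m)=\sum_{\pi\in S_m}q^{\mathrm{inv}(\pi)}\xi_{\pi(1)}\otimes\cdots\otimes\xi_{\pi(m)}$ and $\mathrm{inv}(\pi)$ is the number of inversions of $\pi$ (convention $0^0=1$). It is positive definite for $-1<q<1$; the completion is the $q$-Fock space $\mathcal{F}_q(H)$. For $\xi\in H$, the creation operator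 is $a(\xi)\eta_1\otimes\cdots\otimes\eta_n=\xi\otimes\eta_1\otimes\cdots\otimes\eta_n$, $a(\xi)\Omega=\xi$, and the annihilation operator is $a^*(\xi)\eta_1\otimes\cdots\otimes\eta_n=\sum_{k=1}^n q^{k-1}\langle\eta_k,\xi\rangle\,\eta_1\otimes\cdots\otimes\eta_{k-1}\otimes\eta_{k+1}\otimes\cdots\otimes\eta_n$, $a^*(\xi)\Omega=0$. They extend to bounded operators on $\mathcal{F}_q(H)$, adjoint to each other. The $q$-circular system is $c_i^{(q)}=a(e_i)+a^*(e_{\overline i})$, $1\le i\le d$. $[d]^*$ is the set of finite words in the letters $1,\ldots,d$ (including the empty word), $|w|$ is the length of $w$, and $c_w^{(q)}=c_{w_1}^{(q)}\cdots c_{w_n}^{(q)}$ for $w=w_1\cdots w_n$ (with the empty product equal to $1$). $\|\cdot\|$ is the operator norm on $B(\mathcal{F}_q(H))$, and $\|T\|_2=\tau(T^*T)^{1/2}=\|T\Omega\|_{\mathcal{F}_q(H)}$ for $T$ in the von Neumann algebra $\mathrm{W}^*(c_1^{(q)},\ldots,c_d^{(q)})$, where $\tau(T)=\langle T\Omega,\Omega\rangle_q$. *)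

(* Defs.v *)
From HB Require Import structures.
From mathcomp Require Import all_boot all_order all_algebra all_fingroup.
From mathcomp Require Import all_classical all_reals all_analysis.
From mathcomp Require Import complex.

Set Implicit Arguments.
Unset Strict Implicit.
Unset Printing Implicit Defensive.

Import Order.TTheory GRing.Theory Num.Theory numFieldNormedType.Exports.
Local Open Scope classical_set_scope.
Local Open Scope ring_scope.

Section OneParticleSpace.
Variables (R : realType) (d : nat).

(* H = H_1 (+) H_2 with H_1 = H_2 = C^d, in coordinates: the indices
   lshift d i carry H_1 and the indices rshift d i carry H_2. *)
Definition oneparticle := 'rV[R[i]]_(d + d).

Definition e_vec (i : 'I_d) : oneparticle := delta_mx 0 (lshift d i).
Definition ebar_vec (i : 'I_d) : oneparticle := delta_mx 0 (rshift d i).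

Definition hdot (u v : oneparticle) : R[i] := \sum_j u 0 j * (v 0 j)^*.

End OneParticleSpace.

Section Tensors.
Variables (R : realType) (d : nat).
Local Notation H := (oneparticle R d).

Definition multiindex (n : nat) := {ffun 'I_n -> 'I_(d + d)}.

(* H^{\otimes n}, in coordinates with respect to the orthonormal basis of the
   elementary tensors of basis vectors of H. *)
Definition tensor (n : nat) := {ffun multiindex n -> (R[i])^o}.

Definition tbasis n (t : multiindex n) : tensor n := [ffun s => (s == t)%:R].

Definition elementary n (v : 'I_n -> H) : tensor n :=
  [ffun t : multiindex n => \prod_k v k 0 (t k)].

Definition tdot n (x y : tensor n) : R[i] := \sum_t x t * (y t)^*.

Definition inversions n (p : 'S_n) : nat :=
  #|[set ij : 'I_n * 'I_n | (ij.1 < ij.2)%N && (p ij.2 < p ij.1)%N]|.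

(* P^{(n)} and a^*(xi) are linear extensions of their values on the basis
   tensors, and a(xi) is written in coordinates; qsym_elementary,
   creation_elementary and annihilation_elementary give the values of the
   three operators on all elementary tensors. *)
Definition qsym (q : R) n (x : tensor n) : tensor n :=
  \sum_(t : multiindex n) x t *:
    \sum_(p : 'S_n) (q%:C%C ^+ inversions p) *:
      tbasis [ffun k => t (p k)].

Definition creation (u : H) n (x : tensor n) : tensor n.+1 :=
  [ffun t : multiindex n.+1 => u 0 (t ord0) * x [ffun k => t (lift ord0 k)]].

(* hdot (delta_mx 0 j) u is <e_j, u>; the index k starts at 0, so q ^+ k is
   the factor q^{k-1} of the usual formula. *)
Definition annihilation (q : R) (u : H) n (x : tensor n.+1) : tensor n :=
  \sum_(t : multiindex n.+1) x t *:
    \sum_(k < n.+1) (q%:C%C ^+ k * hdot (delta_mx 0 (t k)) u) *: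
      tbasis [ffun j => t (lift k j)].

Definition vacuum : tensor 0 := [ffun=> 1].

Lemma qsym_elementary (q : R) n (v : 'I_n -> H) :
  qsym q (elementary v) =
    \sum_(p : 'S_n) (q%:C%C ^+ inversions p) *: elementary (fun k => v (p k)).
Proof.
rewrite /qsym; under eq_bigr do rewrite scaler_sumr.
rewrite exchange_big; apply: eq_bigr => p _ /=.
under eq_bigr do rewrite scalerA mulrC -scalerA.
rewrite -scaler_sumr; congr (_ *: _); apply/ffunP => s.
rewrite sum_ffunE (bigD1 [ffun k => s ((p^-1)%g k)]) //= big1 => [|t].
  rewrite addr0 !ffunE.
  have -> : [ffun k => [ffun k => s ((p^-1)%g k)] (p k)] = s.
    by apply/ffunP => k; rewrite !ffunE permK.
  rewrite eqxx /GRing.scale /= mulr1 (reindex_inj (@perm_inj _ p)) /=.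
  by apply: eq_bigr => k _; rewrite ffunE permK.
move=> tP; rewrite !ffunE; case: eqP => [sE|_]; last by rewrite scaler0.
case/eqP: tP; apply/ffunP => k; rewrite ffunE sE ffunE permKV //.
Qed.

Lemma creation_elementary (u : H) n (v : 'I_n -> H) :
  creation u (elementary v) =
    elementary (fun k => if unlift ord0 k is Some j then v j else u).
Proof.
apply/ffunP => t; rewrite !ffunE big_ord_recl unlift_none.
congr (_ * _); apply: eq_bigr => k _.
by rewrite liftK ffunE.
Qed.

Lemma annihilation_elementary (q : R) (u : H) n (v : 'I_n.+1 -> H) :
  annihilation q u (elementary v) =
    \sum_(k < n.+1) (q%:C%C ^+ k * hdot (v k) u) *:
      elementary (fun j => v (lift k j)).
Proof.
rewrite /annihilation; under eq_bigr do rewrite scaler_sumr.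
rewrite exchange_big; apply: eq_bigr => k _ /=.
rewrite -scalerA.
under eq_bigr do rewrite scalerA mulrCA -scalerA.
rewrite -scaler_sumr; congr (_ *: _); apply/ffunP => s.
rewrite sum_ffunE ffunE.
have [ins ins_k ins_lift] : exists2 ins : 'I_(d + d) -> multiindex n.+1,
    forall j, ins j k = j & forall j i, ins j (lift k i) = s i.
  exists (fun j => [ffun i => if unlift k i is Some i' then s i' else j]).
    by move=> j; rewrite ffunE unlift_none.
  by move=> j i; rewrite ffunE liftK.
have insK j : [ffun i => ins j (lift k i)] = s.
  by apply/ffunP => i; rewrite ffunE.
rewrite (bigID (fun t : multiindex n.+1 => [ffun i => t (lift k i)] == s)) /=.
rewrite [X in _ + X]big1 => [|t /negPf tN]; last first.
  by rewrite !ffunE eq_sym tN scaler0.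
rewrite addr0 (reindex ins) /=; last first.
  exists (fun t : multiindex n.+1 => t k) => [j _|t] //.
  move=> /eqP tE; apply/ffunP => i.
  by case: (unliftP k i) => [i' ->|->]; rewrite ?ins_k // ins_lift -tE ffunE.
rewrite (eq_bigl xpredT) => [|j]; last by rewrite insK eqxx.
rewrite /hdot scaler_suml.
apply: eq_bigr => j _.
rewrite !ffunE insK eqxx ins_k /GRing.scale /= mulr1.
rewrite (bigD1_ord k) //= ins_k mulrAC; congr (_ * _ * _).
  rewrite (bigD1 j) //= big1 => [|i ij]; rewrite mxE eqxx /=.
    by rewrite eqxx mul1r addr0.
  by rewrite (negPf ij) mul0r.
by apply: eq_bigr => i _; rewrite ins_lift.
Qed.

End Tensors.

(* A model of F_q(H): a Hilbert space together with an isometric embedding of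
   the algebraic direct sum of the H^{\otimes n}, given by its restrictions to
   the summands, with dense range. *)
Record qFockSpace (R : realType) (d : nat) (q : R) := QFockSpace {
  fock_space :> completeNormedModType R[i];
  fock_dot : {dot fock_space for Num.conj};
  fock_norm : forall x : fock_space, `|x| ^+ 2 = fock_dot x x;
  fock_in : forall n, {linear tensor R d n -> fock_space};
  fock_in_dot : forall n (x y : tensor R d n),
    fock_dot (fock_in n x) (fock_in n y) = tdot (qsym q x) y;
  fock_in_orthogonal : forall m n (x : tensor R d m) (y : tensor R d n),
    m <> n -> fock_dot (fock_in m x) (fock_in n y) = 0;
  fock_in_dense : dense [set x : fock_space |
    exists N (f : forall n, tensor R d n), x = \sum_(n < N) fock_in n (f n)]
}.

Arguments fock_in {R d q} _ _.

Section FockOperators.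
Variables (R : realType) (d : nat) (q : R) (F : qFockSpace d q).
Local Notation H := (oneparticle R d).

(* For linear T these characterise T as the bounded extension to F_q(H) of the
   operator given on the algebraic Fock space. *)
Definition is_creation (u : H) (T : F -> F) : Prop :=
  continuous T /\
  forall n (x : tensor R d n), T (fock_in F n x) = fock_in F n.+1 (creation u x).

Definition is_annihilation (u : H) (T : F -> F) : Prop :=
  [/\ continuous T,
      forall x : tensor R d 0, T (fock_in F 0 x) = 0 &
      forall n (x : tensor R d n.+1),
        T (fock_in F n.+1 x) = fock_in F n (annihilation q u x)].

Definition circular (a astar : H -> F -> F) (i : 'I_d) (x : F) : F :=
  a (e_vec R i) x + astar (ebar_vec R i) x.

Definition word_op (c : 'I_d -> F -> F) (w : seq 'I_d) : F -> F :=
  foldr (fun i T => c i \o T) id w.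

Definition hom_poly (c : 'I_d -> F -> F) (alpha : seq 'I_d -> R[i]) (n : nat)
    (x : F) : F :=
  \sum_(w : n.-tuple 'I_d) alpha w *: word_op c w x.

(* The norm of F takes its values in R[i]; Re reads it as a real number. *)
Definition opnorm (T : F -> F) : \bar R :=
  ereal_sup [set (complex.Re `|T x|)%:E | x in [set x : F | `|x| <= 1]].

(* ||T||_2 = ||T Omega||. *)
Definition norm2 (T : F -> F) : R :=
  complex.Re `|T (fock_in F 0 (vacuum R d))|.

End FockOperators.

(* Main.v *)
From HB Require Import structures.
Require Import Defs.
From mathcomp Require Import all_boot all_order all_algebra all_fingroup.
From mathcomp Require Import all_classical all_reals all_analysis.
From mathcomp Require Import complex.
From mathcomp Require Import ring lra zify.

Set Implicit Arguments.
Unset Strict Implicit.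
Unset Printing Implicit Defensive.

Import Order.TTheory GRing.Theory Num.Theory numFieldNormedType.Exports.
Local Open Scope ring_scope.

(** The vectors e_i and ebar_j are orthogonal, so the q-commutation relation
    between a^*(ebar_j) and a(e_i) has no constant term:
    a^*(ebar_j) a(e_i) = q a(e_i) a^*(ebar_j).  Hence c_w can be put in normal
    order without contractions, and T = sum_w alpha_w c_w is the sum over
    k = 0..n of operators T_k which first annihilate n - k barred letters and
    then create k unbarred ones; the coefficients come from the braided
    unshuffles of w ([circ_word_expand]).

    Each T_k is bounded by a constant times ||T||_2.  Concatenation of a vector
    of degree k with an arbitrary vector is bounded by a constant C(|q|)
    independent of k and of d ([concat_tuples], [rowop_le]): on homogeneous
    vectors the Gram matrix of concatenated words is D S, with S the tensor
    product of two Gram matrices and D the unshuffle operator, whose sup norm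
    is at most a Gaussian binomial in |q|, and Lax's symmetrization lemma turns
    this sup norm bound into D S <= C S ([lax_symmetrization],
    [concat_homogeneous]).  Unshuffling is the adjoint of concatenation
    ([qgram_cat]), so the same constant bounds the Hilbert-Schmidt norm of the
    kernel of T_k in orthonormal families by ||T||_2 ([kernel_coeff_le]).

    Adding up the n + 1 operators T_k by the triangle inequality would lose a
    factor n + 1.  To lose only its square root, the vectors obtained from xi
    by annihilating barred letters are split as w = w1 + w2, where w1 is killed
    by all a^*(e_i).  Creating k unbarred letters on such vectors w1 gives
    vectors that are orthogonal for different k (they belong to different
    summands of the Wold decomposition for the letters e_i), so that squares
    add up.  The remainders w2 are square summable over k: a vector with s
    leading barred letters is almost orthogonal to a vector with l leading
    unbarred letters, because moving the ones across the others costs a factor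
    q^(l s) ([wold_pairing]); so w2 only sees the Wold components of xi for the
    letters ebar_i with geometrically small weights ([wold_split]), and the
    Cauchy-Schwarz inequality over k is enough ([haagerup_fin]).

    All this takes place on finite combinations of words, for any operators
    satisfying the q-commutation relations; the bound extends to the completed
    Fock space by density ([haagerup_norm]). *)

(** * Positive semidefinite Hermitian forms *)

Lemma cauchy_schwarz_sum (R : realType) (I : finType) (x y : I -> R) :
  (\sum_i x i * y i) ^+ 2 <= (\sum_i x i ^+ 2) * (\sum_i y i ^+ 2).
Proof.
rewrite -subr_ge0.
suff -> : (\sum_i x i ^+ 2) * (\sum_i y i ^+ 2) - (\sum_i x i * y i) ^+ 2 =
   2^-1 * \sum_i \sum_j (x i * y j - x j * y i) ^+ 2.
  rewrite mulr_ge0 ?invr_ge0 ?ler0n// sumr_ge0// => i _.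
  by rewrite sumr_ge0// => j _; rewrite sqr_ge0.
have -> : \sum_i \sum_j (x i * y j - x j * y i) ^+ 2 =
  \sum_i \sum_j (x i ^+ 2 * y j ^+ 2) + \sum_i \sum_j (y i ^+ 2 * x j ^+ 2)
   - 2 * \sum_i \sum_j (x i * y i * (x j * y j)).
  rewrite mulr_sumr -sumrN -!big_split /=; apply: eq_bigr => i _.
  rewrite mulr_sumr -sumrN -!big_split /=; apply: eq_bigr => j _.
  by ring.
rewrite expr2 !big_distrlr /=.
rewrite [X in _ + X - _]exchange_big /=.
under [X in _ + X - _]eq_bigr => i _ do
  under eq_bigr => j _ do rewrite mulrC.
by field.
Qed.

Section PsdForm.
Variable R : realType.
Local Notation K := R[i].

(** Definiteness is not part of the record: for the form to which Lax's lemma is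
    applied below, a tensor product of Gram matrices, only semidefiniteness is
    visible. *)
Record psd_form (V : lmodType K) := PsdForm {
  psd_fun :> V -> V -> K;
  psd_linear : forall c x y z,
    psd_fun (c *: x + y) z = c * psd_fun x z + psd_fun y z;
  psd_sym : forall x y, psd_fun y x = (psd_fun x y)^*;
  psd_ge0 : forall x, 0 <= psd_fun x x
}.

Definition cabs (z : K) : R := complex.Re `|z|.

Lemma cabsE z : (cabs z)%:C%C = `|z|.
Proof. by rewrite /cabs RRe_real// normr_real. Qed.

Lemma cabs_ge0 z : 0 <= cabs z.
Proof. by rewrite -ler0c cabsE. Qed.

Lemma real_complexM (a b : R) : (a * b)%:C%C = a%:C%C * b%:C%C :> K.
Proof. exact: rmorphM. Qed.

Lemma cabsM z t : cabs (z * t) = cabs z * cabs t.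
Proof. by apply: (@complexI R); rewrite real_complexM !cabsE normrM. Qed.

Lemma cabsD z t : cabs (z + t) <= cabs z + cabs t.
Proof. by rewrite -lecR rmorphD /= !cabsE ler_normD. Qed.

Lemma cabs_sum (I : Type) (s : seq I) (P : pred I) (z : I -> K) :
  cabs (\sum_(i <- s | P i) z i) <= \sum_(i <- s | P i) cabs (z i).
Proof.
elim/big_ind2: _ => //; first by rewrite /cabs normr0.
by move=> z1 r1 z2 r2 h1 h2; rewrite (le_trans (cabsD _ _))// lerD.
Qed.

Lemma cabs0 : cabs 0 = 0.
Proof. by rewrite /cabs normr0. Qed.

Lemma cabs1 : cabs 1 = 1.
Proof. by rewrite /cabs normr1. Qed.

Lemma cabsX z n : cabs (z ^+ n) = cabs z ^+ n.
Proof. by elim: n => [|n IH]; rewrite ?cabs1// !exprS cabsM IH. Qed.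

Lemma cabs_real (a : R) : cabs a%:C%C = `|a|.
Proof.
by rewrite /cabs normc_def /= expr0n /= addr0 sqrtr_sqr.
Qed.

Lemma mul_conj_cabs z : z * z^* = (cabs z ^+ 2)%:C%C.
Proof. by rewrite -normCK -cabsE rmorphXn. Qed.

Lemma Re_le_cabs z : complex.Re z <= cabs z.
Proof.
apply: le_trans (ler_norm _) _.
by rewrite -lecR cabsE normc_ge_Re.
Qed.

Lemma Re_sum (I : Type) (s : seq I) (P : pred I) (z : I -> K) :
  complex.Re (\sum_(i <- s | P i) z i) = \sum_(i <- s | P i) complex.Re (z i).
Proof.
elim/big_rec2: _ => // i a b _ <-.
by case: (z i) b => [? ?] [].
Qed.

Lemma ReD (z t : K) : complex.Re (z + t) = complex.Re z + complex.Re t.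
Proof. by case: z t => [? ?] []. Qed.

Lemma conj_real (a : R) : (a%:C%C)^* = a%:C%C :> K.
Proof. exact: conjc_real. Qed.

Section Theory.
Variables (V : lmodType K) (f : psd_form V).
Implicit Types x y z : V.

Definition sqn x : R := complex.Re (f x x).
Definition nrm x : R := Num.sqrt (sqn x).

Lemma psdDl x y z : f (x + y) z = f x z + f y z.
Proof. by have := psd_linear f 1 x y z; rewrite scale1r mul1r. Qed.

Lemma psd0l z : f 0 z = 0.
Proof. by apply: (addrI (f 0 z)); rewrite -psdDl !addr0. Qed.

Lemma psdZl c x z : f (c *: x) z = c * f x z.
Proof. by have := psd_linear f c x 0 z; rewrite psd0l !addr0. Qed.

Lemma psdDr x y z : f z (x + y) = f z x + f z y.
Proof. by rewrite psd_sym psdDl rmorphD /= -!psd_sym. Qed.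

Lemma psd0r z : f z 0 = 0.
Proof. by rewrite psd_sym psd0l rmorph0. Qed.

Lemma psdZr c x z : f z (c *: x) = c^* * f z x.
Proof. by rewrite psd_sym psdZl rmorphM /= -psd_sym. Qed.

Lemma psdNl x z : f (- x) z = - f x z.
Proof. by rewrite -scaleN1r psdZl mulN1r. Qed.

Lemma psdNr x z : f z (- x) = - f z x.
Proof. by rewrite psd_sym psdNl rmorphN /= -psd_sym. Qed.

Lemma psd_suml (I : Type) (s : seq I) (P : pred I) (x : I -> V) z :
  f (\sum_(i <- s | P i) x i) z = \sum_(i <- s | P i) f (x i) z.
Proof.
by apply: (big_morph (f^~ z)) => [? ?|]; rewrite ?psd0l// psdDl.
Qed.

Lemma psd_sumr (I : Type) (s : seq I) (P : pred I) (x : I -> V) z :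
  f z (\sum_(i <- s | P i) x i) = \sum_(i <- s | P i) f z (x i).
Proof. by apply: (big_morph (f z)) => [? ?|]; rewrite ?psd0r// psdDr. Qed.

Lemma sqnE x : f x x = (sqn x)%:C%C.
Proof. by rewrite /sqn RRe_real// ger0_real// psd_ge0. Qed.

Lemma sqn_ge0 x : 0 <= sqn x.
Proof. by rewrite -ler0c -sqnE psd_ge0. Qed.

Lemma nrm_ge0 x : 0 <= nrm x. Proof. exact: sqrtr_ge0. Qed.

Lemma sqr_nrm x : nrm x ^+ 2 = sqn x.
Proof. by rewrite sqr_sqrtr// sqn_ge0. Qed.

Lemma sqn0 : sqn 0 = 0.
Proof. by rewrite /sqn psd0l. Qed.

Lemma sqnZ c x : sqn (c *: x) = cabs c ^+ 2 * sqn x.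
Proof.
apply: (@complexI R); rewrite -sqnE psdZl psdZr mulrA mul_conj_cabs sqnE.
by rewrite -real_complexM.
Qed.

Lemma nrmZ c x : nrm (c *: x) = cabs c * nrm x.
Proof. by rewrite /nrm sqnZ sqrtrM ?sqr_ge0// sqrtr_sqr ger0_norm// cabs_ge0. Qed.

(** The discriminant argument along the line x - t f(x, y) y, t real; when
    f(y, y) = 0 a large t is used instead of the minimiser. *)
Lemma psd_CS x y : cabs (f x y) ^+ 2 <= sqn x * sqn y.
Proof.
have key (t : R) : 0 <= sqn x - 2 * t * cabs (f x y) ^+ 2
    + t ^+ 2 * (cabs (f x y) ^+ 2 * sqn y).
  have := psd_ge0 f (x - (t%:C%C * f x y) *: y).
  rewrite psdDl !psdDr !psdNl !psdNr psdZl !psdZr psdZl (psd_sym f x y).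
  rewrite opprK rmorphM /= conj_real !sqnE.
  set a := f x y; move=> h; rewrite -ler0c.
  move: (mul_conj_cabs a); move: (cabs a ^+ 2) => M aM.
  have -> : sqn x - 2 * t * M + t ^+ 2 * (M * sqn y) =
    sqn x - (t + t) * M + t * t * (M * sqn y) by ring.
  rewrite !(rmorphD, rmorphN, rmorphM) /= -aM.
  apply: le_trans h _; rewrite le_eqVlt; apply/orP; left; apply/eqP.
  by ring.
have [y0|y0] := eqVneq (sqn y) 0.
  rewrite y0 mulr0; move: key; rewrite y0.
  have := sqn_ge0 x; set b := cabs _ ^+ 2; set s := sqn x => s0 key.
  have b0 : 0 <= b by rewrite exprn_ge0// cabs_ge0.
  rewrite leNgt; apply/negP => bp.
  have := key ((s + 1) / b); rewrite !mulr0 addr0 -(mulrA 2).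
  by rewrite (divfK (lt0r_neq0 bp)); lra.
have yp : 0 < sqn y by rewrite lt_neqAle eq_sym y0 sqn_ge0.
have := key (sqn y)^-1; set b := cabs _ ^+ 2 => h.
rewrite -ler_pdivrMr//.
suff : sqn x - b / sqn y = sqn x - 2 * (sqn y)^-1 * b +
   (sqn y)^-1 ^+ 2 * (b * sqn y) by rewrite -subr_ge0 => ->.
by field.
Qed.

Lemma psd_CS_nrm x y : cabs (f x y) <= nrm x * nrm y.
Proof.
rewrite -(@ler_pXn2r _ 2) ?nnegrE ?mulr_ge0 ?nrm_ge0 ?cabs_ge0//.
by rewrite exprMn !sqr_nrm psd_CS.
Qed.

Lemma nrmD x y : nrm (x + y) <= nrm x + nrm y.
Proof.
rewrite -(@ler_pXn2r _ 2) ?nnegrE ?addr_ge0 ?nrm_ge0//.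
rewrite sqr_nrm /sqn psdDl !psdDr !ReD -!/(sqn _) -!sqr_nrm.
have h1 := le_trans (Re_le_cabs _) (psd_CS_nrm x y).
have h2 := le_trans (Re_le_cabs _) (psd_CS_nrm y x).
by rewrite sqrrD; lra.
Qed.

Lemma nrm_sum (I : Type) (s : seq I) (P : pred I) (x : I -> V) :
  nrm (\sum_(i <- s | P i) x i) <= \sum_(i <- s | P i) nrm (x i).
Proof.
elim/big_ind2: _ => //; first by rewrite /nrm sqn0 sqrtr0.
by move=> z1 r1 z2 r2 h1 h2; rewrite (le_trans (nrmD _ _))// lerD.
Qed.

Lemma sqn_lincomb (I : finType) (b : I -> K) (w : I -> V) :
  sqn (\sum_i b i *: w i) <= (\sum_i cabs (b i) ^+ 2) * (\sum_i sqn (w i)).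
Proof.
apply: (@le_trans _ _ ((\sum_i cabs (b i) * nrm (w i)) ^+ 2)).
  rewrite -sqr_nrm ler_pXn2r ?nnegrE ?nrm_ge0 ?sumr_ge0//.
    rewrite (le_trans (nrm_sum _ _ _))//.
    by apply: ler_sum => i _; rewrite nrmZ.
  by move=> i _; rewrite mulr_ge0// ?cabs_ge0 ?nrm_ge0.
rewrite (le_trans (cauchy_schwarz_sum _ _))//.
by under [X in _ * X <= _]eq_bigr => i _ do rewrite sqr_nrm.
Qed.

Lemma sqn_sum_le (I : finType) (w : I -> V) :
  sqn (\sum_i w i) <= #|I|%:R * (\sum_i sqn (w i)).
Proof.
have := sqn_lincomb (fun=> 1) w.
under [X in sqn X <= _]eq_bigr => i _ do rewrite scale1r.
by rewrite cabs1 expr1n sumr_const.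
Qed.

Lemma sqnD_le x y : sqn (x + y) <= 2 * (sqn x + sqn y).
Proof.
have := @sqn_sum_le bool (fun b => if b then x else y).
by rewrite !big_bool card_bool.
Qed.

Lemma psd_CS_sum (I : finType) (x y : I -> V) :
  cabs (\sum_i f (x i) (y i)) ^+ 2 <=
    (\sum_i sqn (x i)) * (\sum_i sqn (y i)).
Proof.
apply: (@le_trans _ _ ((\sum_i nrm (x i) * nrm (y i)) ^+ 2)).
  rewrite ler_pXn2r ?nnegrE ?cabs_ge0 ?sumr_ge0//.
    rewrite (le_trans (cabs_sum _ _ _))//.
    by apply: ler_sum => i _; rewrite psd_CS_nrm.
  by move=> i _; rewrite mulr_ge0// ?nrm_ge0.
rewrite (le_trans (cauchy_schwarz_sum _ _))//.
under eq_bigr => i _ do rewrite sqr_nrm.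
by under [X in _ * X <= _]eq_bigr => i _ do rewrite sqr_nrm.
Qed.

Lemma sqn_pythagoras (I : finType) (x : I -> V) :
  (forall i j, i != j -> f (x i) (x j) = 0) ->
  sqn (\sum_i x i) = \sum_i sqn (x i).
Proof.
move=> o; rewrite /sqn psd_suml Re_sum; apply: eq_bigr => i _.
by rewrite psd_sumr (bigD1 i)//= big1 ?addr0// => j ji; rewrite o// eq_sym.
Qed.

End Theory.
End PsdForm.

Arguments psd_fun : simpl never.

(** * Lax's symmetrization lemma *)

Lemma geometric_unbounded (R : realType) (c b : R) : 1 < c ->
  exists n, b < c ^+ n.
Proof.
move=> c1; have h0 : 0 < c - 1 by rewrite subr_gt0.
have bern n : 1 + n%:R * (c - 1) <= c ^+ n.
  elim: n => [|n IH]; first by rewrite mul0r addr0.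
  rewrite exprS; apply: le_trans (ler_wpM2l _ IH); last by lra.
  have : 0 <= n%:R * (c - 1) ^+ 2 by rewrite mulr_ge0 ?ler0n ?sqr_ge0.
  by rewrite -natr1; lra.
have [n hn] : exists n : nat, b / (c - 1) < n%:R.
  exists (Num.bound `|b / (c - 1)|).
  exact: le_lt_trans (ler_norm _) (archi_boundP (normr_ge0 _)).
exists n; apply: lt_le_trans (bern n).
by move: hn; rewrite ltr_pdivrMr//; lra.
Qed.

(** The ratios of consecutive terms of a log-convex sequence increase, so a
    first ratio larger than rho would force growth faster than rho^j. *)
Lemma logconvex_ratio (R : realType) (u : nat -> R) (M rho : R) : 0 < rho ->
  (forall j, 0 <= u j) -> (forall j, u j.+1 ^+ 2 <= u j.+2 * u j) ->
  (forall j, u j <= M * rho ^+ j) -> u 1%N <= rho * u 0%N.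
Proof.
move=> rho0 u0 lc ub; rewrite leNgt; apply/negP => lt1.
have u1p : 0 < u 1%N by apply: le_lt_trans lt1; rewrite mulr_ge0// ltW.
have u0p : 0 < u 0%N.
  rewrite lt_neqAle u0 andbT; apply/eqP => e.
  by have := lc 0%N; rewrite -e mulr0 leNgt exprn_gt0.
pose k := u 1%N / u 0%N.
have kp : 0 < k by rewrite divr_gt0.
have krho : rho < k by rewrite ltr_pdivlMr.
have mono j : 0 < u j /\ k * u j <= u j.+1.
  elim: j => [|j [p IH]]; first by split=> //; rewrite /k divfK// gt_eqF.
  have p1 : 0 < u j.+1 by apply: lt_le_trans IH; rewrite mulr_gt0.
  split=> //; rewrite -(ler_pM2r p); apply: le_trans (lc j).
  by rewrite expr2 mulrAC mulrC ler_pM2l.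
have geo j : k ^+ j * u 0%N <= u j.
  elim: j => [|j IH]; first by rewrite mul1r.
  by apply: le_trans (mono j).2; rewrite exprS -mulrA ler_pM2l.
have kr : 1 < k / rho by rewrite ltr_pdivlMr// mul1r.
have [n] := geometric_unbounded (M / u 0%N) kr.
rewrite ltr_pdivrMr// expr_div_n mulrAC ltr_pdivlMr ?exprn_gt0//.
by rewrite ltNge (le_trans (geo n)).
Qed.

(** An operator which is symmetric for s is controlled in the seminorm of s by
    its growth in any other norm: the numbers s(T^j x, T^j x) form a log-convex
    sequence by Cauchy-Schwarz. This replaces the operator monotonicity of the
    square root in the comparison of D S with S. *)
Lemma lax_symmetrization (R : realType) (V : lmodType R[i]) (s : psd_form V)
    (T : V -> V) (x : V) (M rho : R) : 0 < rho ->
  (forall y z, s (T y) z = s y (T z)) ->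
  (forall j, cabs (s (iter j T x) x) <= M * rho ^+ j) ->
  complex.Re (s (T x) x) <= rho * sqn s x.
Proof.
move=> rho0 Tsym Tbound; pose u j := sqn s (iter j T x).
have su i j : s (iter i T x) (iter j T x) = s (iter (i + j) T x) x.
  elim: j i => [|j IH] i; first by rewrite addn0.
  by rewrite /= -Tsym -iterS IH addSnnS.
have u1 : u 1%N <= rho ^+ 2 * u 0%N.
  apply: (@logconvex_ratio _ u M); rewrite ?exprn_gt0//.
  - by move=> j; exact: sqn_ge0.
  - move=> j; apply: le_trans (psd_CS s _ _).
    have -> : s (iter j.+2 T x) (iter j T x) = s (iter j.+1 T x) (iter j.+1 T x).
      by rewrite !su; congr (s (iter _ T x) x); lia.
    by rewrite /u sqnE cabs_real ger0_norm ?sqn_ge0.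
  - move=> j; rewrite /u; apply: le_trans (Re_le_cabs _) _.
    by rewrite su (le_trans (Tbound _))// -exprM addnn mul2n.
apply: le_trans (Re_le_cabs _) _.
rewrite -(@ler_pXn2r _ 2) ?nnegrE ?cabs_ge0 ?mulr_ge0 ?sqn_ge0 ?(ltW rho0)//.
apply: le_trans (psd_CS s _ _) _.
by rewrite exprMn expr2 mulrA ler_wpM2r// ?sqn_ge0.
Qed.

(** * Braided derivations and unshuffles of words *)

Section WordFunctionals.
Variables (R : realType) (q : R) (I : eqType).
Local Notation K := R[i].
Local Notation qc := (q%:C%C : K).

(** The linear combination of words obtained by deleting one letter i from w,
    the deletion at position p having weight q^p, is represented by the
    functional that it induces on functions g of words. With this encoding,
    composition of operations on words is composition of functionals. *)
Fixpoint der (V : lmodType K) (i : I) (w : seq I) (g : seq I -> V) : V :=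
  if w is j :: w' then
    (if i == j then g w' else 0) + qc *: der i w' (fun v => g (j :: v))
  else 0.

(** The component of bidegree (k, |w| - k) of the braided coproduct of w, as a
    functional: the sum over the subwords u of length k and their complements v
    of G u v, weighted by q to the number of pairs of a letter of v that stands
    in w before a letter of u. *)
Fixpoint unshuffle (V : lmodType K) (k : nat) (w : seq I)
    (G : seq I -> seq I -> V) : V :=
  if w is j :: w' then
    (if k is k'.+1 then unshuffle k' w' (fun u v => G (j :: u) v) else 0)
    + qc ^+ k *: unshuffle k w' (fun u v => G u (j :: v))
  else if k is 0%N then G [::] [::] else 0.

(** The q-inner product of two words in orthonormal letters, computed by
    annihilating the letters of v one after the other. *)
Fixpoint qgram (u v : seq I) : K :=
  if v is i :: v' then der i u (fun u' => qgram u' v' : K^o) else (u == [::])%:R.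

(** Real-linear maps: as q is real, the functionals above commute both with
    linear and with conjugate-linear maps, and both are needed. *)
Definition rlin (V W : lmodType K) (phi : V -> W) :=
  (forall x y, phi (x + y) = phi x + phi y) /\
  (forall (a : R) x, phi (a%:C%C *: x) = a%:C%C *: phi x).

Lemma rlin0 (V W : lmodType K) (phi : V -> W) : rlin phi -> phi 0 = 0.
Proof. by case=> pD _; apply: (addrI (phi 0)); rewrite -pD !addr0. Qed.

Lemma rlinX (V W : lmodType K) (phi : V -> W) k x : rlin phi ->
  phi (qc ^+ k *: x) = qc ^+ k *: phi x.
Proof. by case=> _ pZ; rewrite -rmorphXn pZ. Qed.

Lemma der_ext (V : lmodType K) i w (g h : seq I -> V) :
  (forall v, (size v).+1 = size w -> g v = h v) -> der i w g = der i w h.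
Proof.
elim: w g h => //= j w IH g h gh; congr (_ + _ *: _).
  by case: eqP => // _; apply: gh.
by apply: IH => v sv; apply: gh; rewrite /= sv.
Qed.

Lemma rlin_der (V W : lmodType K) (phi : V -> W) i w (g : seq I -> V) :
  rlin phi -> phi (der i w g) = der i w (fun v => phi (g v)).
Proof.
move=> pl; elim: w g => [|j w IH] g /=; first exact: rlin0.
rewrite pl.1 -(expr1 qc) rlinX// IH; congr (_ + _).
by case: eqP => // _; exact: rlin0.
Qed.

Lemma der_add (V : lmodType K) i w (g h : seq I -> V) :
  der i w (fun v => g v + h v) = der i w g + der i w h.
Proof.
elim: w g h => [|j w IH] g h /=; first by rewrite addr0.
by rewrite IH scalerDr addrACA; congr (_ + _); case: eqP; rewrite ?addr0.
Qed.

Lemma der_scale (V : lmodType K) c i w (g : seq I -> V) :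
  der i w (fun v => c *: g v) = c *: der i w g.
Proof.
elim: w g => [|j w IH] g /=; first by rewrite scaler0.
rewrite IH scalerDr scalerA mulrC -scalerA; congr (_ + _).
by case: eqP; rewrite ?scaler0.
Qed.

Lemma der_ind (V : lmodType K) (S : V -> Prop) i w (g : seq I -> V) : S 0 ->
  (forall x y, S x -> S y -> S (x + y)) -> (forall c x, S x -> S (c *: x)) ->
  (forall v, (size v).+1 = size w -> S (g v)) -> S (der i w g).
Proof.
move=> S0 SD SZ; elim: w g => //= j w IH g gS.
apply: SD; first by case: eqP => // _; apply: gS.
by apply/SZ/IH => v sv; apply: gS; rewrite /= sv.
Qed.

Lemma unshuffle_ext (V : lmodType K) k w (G H : seq I -> seq I -> V) :
  (forall u v, size u = k -> (k + size v)%N = size w -> G u v = H u v) ->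
  unshuffle k w G = unshuffle k w H.
Proof.
elim: w k G H => [|j w IH] [|k] G H GH //=; first exact: GH.
  rewrite !add0r; congr (_ *: _); apply: IH => u v su sv.
  by apply: GH => //=; rewrite -sv.
congr (_ + _ *: _); apply: IH => u v su sv; apply: GH => //=.
- by rewrite su.
- by rewrite addSn sv.
- by rewrite addnS sv.
Qed.

Lemma rlin_unshuffle (V W : lmodType K) (phi : V -> W) k w
    (G : seq I -> seq I -> V) : rlin phi ->
  phi (unshuffle k w G) = unshuffle k w (fun u v => phi (G u v)).
Proof.
move=> pl; elim: w k G => [|j w IH] k G /=.
  by case: k => [|k] //=; rewrite rlin0.
rewrite pl.1 rlinX// IH; congr (_ + _).
by case: k => [|k]; [rewrite rlin0|rewrite IH].
Qed.

Lemma unshuffle_add (V : lmodType K) k w (G H : seq I -> seq I -> V) :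
  unshuffle k w (fun u v => G u v + H u v) = unshuffle k w G + unshuffle k w H.
Proof.
elim: w k G H => [|j w IH] k G H /=; first by case: k; rewrite ?addr0.
rewrite IH scalerDr addrACA; congr (_ + _).
by case: k => [|k]; rewrite ?addr0// IH.
Qed.

Lemma unshuffle0 (V : lmodType K) k w :
  unshuffle k w (fun _ _ => 0 : V) = 0.
Proof.
elim: w k => [|j w IH] [|k] //=; rewrite !IH ?scaler0 ?addr0//.
Qed.

Lemma unshuffle_sum (V : lmodType K) (J : Type) (s : seq J) (P : pred J) k w
    (G : J -> seq I -> seq I -> V) :
  unshuffle k w (fun u v => \sum_(j <- s | P j) G j u v) =
  \sum_(j <- s | P j) unshuffle k w (G j).
Proof.
elim: s => [|j s IH].
  rewrite big_nil -[RHS](unshuffle0 V k w).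
  by apply: unshuffle_ext => u v _ _; rewrite big_nil.
rewrite big_cons -IH; case: ifP => Pj; last first.
  by apply: unshuffle_ext => u v _ _; rewrite big_cons Pj.
by rewrite -unshuffle_add; apply: unshuffle_ext => u v _ _; rewrite big_cons Pj.
Qed.

Lemma unshuffle_big (V : lmodType K) k w (G : seq I -> seq I -> V) :
  (size w < k)%N -> unshuffle k w G = 0.
Proof.
elim: w k G => [|j w IH] [|k] G //= wk.
rewrite IH// IH ?scaler0 ?addr0//; exact: leq_trans (leqnSn _) wk.
Qed.

Lemma unshuffle_left0 (V : lmodType K) w (G : seq I -> seq I -> V) :
  unshuffle 0 w G = G [::] w.
Proof. by elim: w G => //= j w IH G; rewrite IH expr0 scale1r add0r. Qed.

Lemma unshuffle_leftT (V : lmodType K) w (G : seq I -> seq I -> V) :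
  unshuffle (size w) w G = G w [::].
Proof.
by elim: w G => //= j w IH G; rewrite IH unshuffle_big// scaler0 addr0.
Qed.

(** Coassociativity: deleting a letter and then unshuffling is the same as
    unshuffling and then deleting a letter of the left part. *)
Lemma der_unshuffle (V : lmodType K) i k w (G : seq I -> seq I -> V) :
  unshuffle k.+1 w (fun u v => der i u (fun u' => G u' v)) =
  der i w (fun w' => unshuffle k w' G).
Proof.
elim: w k G => //= j w IH k G.
rewrite unshuffle_add -addrA; congr (_ + _).
  by case: eqP => // _; rewrite unshuffle0.
rewrite der_add scalerDr; congr (_ + _); last first.
  by rewrite IH der_scale scalerA exprS.
rewrite -(@rlin_unshuffle _ _ (fun x : V => qc *: x)); last first.
  by split=> [x y|a x]; rewrite ?scalerDr// !scalerA mulrC.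
congr (_ *: _); case: k => [|k]; last by rewrite IH.
rewrite unshuffle_left0 /=.
by elim: w {IH} => //= j' w IH; rewrite -IH scaler0 addr0; case: eqP.
Qed.

End WordFunctionals.

(** * Gram matrices of words *)

Section WordGram.
Variables (R : realType) (q : R) (I : eqType).
Local Notation K := R[i].
Local Notation qc := (q%:C%C : K).
Local Notation gram := (qgram q).
Implicit Types u v w : seq I.

Lemma rlin_scale (V : lmodType K) (x : V) : rlin (fun c : K^o => c *: x).
Proof. by split=> [a b|a b]; rewrite ?scalerDl// -scalerA. Qed.

Lemma rlin_mulr (c : K) : rlin (fun x : K^o => x * c : K^o).
Proof. exact: (rlin_scale (c : K^o)). Qed.

(** Unshuffling is the adjoint of concatenation for the q-inner product; this
    follows from [der_unshuffle], one letter of u at a time. *)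
Lemma qgram_cat w u v : gram w (u ++ v) =
  unshuffle q (size u) w (fun u' v' => gram u' u * gram v' v : K^o).
Proof.
elim: u w => [|i u IH] w /=; first by rewrite unshuffle_left0 /= mul1r.
transitivity (der q i w (fun w' =>
   unshuffle q (size u) w' (fun u' v' => gram u' u * gram v' v : K^o))).
  by apply: der_ext => w' _; exact: IH.
rewrite -der_unshuffle; apply: unshuffle_ext => u' v' _ _.
by rewrite -(rlin_der _ _ _ _ (rlin_mulr (gram v' v))).
Qed.

Lemma qgram_size u v : size u != size v -> gram u v = 0.
Proof.
elim: v u => [|i v IH] u /=; first by case: u.
move=> uv; rewrite (@der_ext _ _ _ _ _ _ _ (fun=> 0 : K^o)); last first.
  by move=> u' su; apply: IH; apply: contraNneq uv => <-; rewrite su.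
rewrite -[RHS](@scale0r K K^o (der q i u (fun=> 0))) -der_scale.
by apply: der_ext => ? _; rewrite scaler0.
Qed.

Lemma qgram_real u v : (gram u v)^* = gram u v.
Proof.
elim: v u => [|i v IH] u /=; first by rewrite rmorph_nat.
rewrite (@rlin_der _ q I K^o K^o (fun x => x^*)).
  by apply: der_ext => *; exact: IH.
by split=> [x y|a x]; rewrite ?rmorphD// [LHS]rmorphM /= conj_real.
Qed.

(** Deletion of a letter weighted by the letters to its right instead of those
    to its left; it computes the q-inner product from the last letter. *)
Fixpoint rder (V : lmodType K) (i : I) (w : seq I) (g : seq I -> V) : V :=
  if w is j :: w' then
    (if i == j then qc ^+ size w' *: g w' else 0) + rder i w' (fun v => g (j :: v))
  else 0.

Lemma der_rcons (V : lmodType K) i w j (g : seq I -> V) :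
  der q i (rcons w j) g = der q i w (fun v => g (rcons v j)) +
    qc ^+ size w *: (if i == j then g w else 0).
Proof.
elim: w g => [|k w IH] g /=; first by rewrite scaler0 addr0 add0r expr0 scale1r.
by rewrite IH scalerDr scalerA -exprS addrA.
Qed.

Lemma rder_rev (V : lmodType K) i w (g : seq I -> V) :
  rder i w g = der q i (rev w) (fun v => g (rev v)).
Proof.
elim: w g => [|j w IH] g //=; rewrite rev_cons der_rcons addrC IH size_rev revK.
congr (_ + _); first by apply: der_ext => v _; rewrite rev_rcons.
by case: eqP; rewrite ?scaler0.
Qed.

Lemma unshuffle_last i k w (g : seq I -> K^o) : size w = k.+1 ->
  unshuffle q k w (fun u v => g u * gram v [:: i] : K^o) = rder i w g.
Proof.
elim: w k g => //= j w IH k g [sw].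
rewrite addrC; congr (_ + _).
  rewrite -{2}sw unshuffle_leftT /= scaler0 addr0 sw.
  by case: eqP; rewrite ?mulr1 ?mulr0 ?scaler0.
case: k sw => [|k] sw; last exact: IH.
by case: w sw {IH}.
Qed.

Lemma qgram_rcons w u i : gram w (rcons u i) =
  der q i (rev w) (fun v => gram (rev v) u : K^o).
Proof.
have [sw|sw] := eqVneq (size w) (size u).+1.
  by rewrite -cats1 qgram_cat unshuffle_last// rder_rev.
rewrite qgram_size ?size_rcons//.
rewrite -[LHS](@scale0r K K^o (der q i (rev w) (fun=> 0))) -der_scale.
apply: der_ext => v; rewrite size_rev => sv; rewrite scaler0 qgram_size//.
by rewrite size_rev; apply: contraNneq sw => <-; rewrite sv.
Qed.

(** In normal order the annihilated letters appear in the order of w, whereas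
    the adjoint of a creation word reverses them; this symmetry, which compares
    [der] and [rder], absorbs the discrepancy. *)
Lemma qgram_rev u v : gram (rev u) (rev v) = gram u v.
Proof.
elim: v u => [|i v IH] u /=.
  by congr (_ %:R); congr nat_of_bool; rewrite -!size_eq0 size_rev.
by rewrite rev_cons qgram_rcons revK; apply: der_ext => w _; exact: IH.
Qed.

(** The Gaussian binomial coefficient, by the recursion that matches
    [unshuffle]. *)
Fixpoint qbin (r : R) (k n : nat) : R :=
  if n is n'.+1 then
    (if k is k'.+1 then qbin r k' n' else 0) + r ^+ k * qbin r k n'
  else (k == 0%N)%:R.

Lemma unshuffle_bound k w (G : seq I -> seq I -> K^o) (b : R) :
  (forall u v, cabs (G u v) <= b) ->
  cabs (unshuffle q k w G) <= qbin `|q| k (size w) * b.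
Proof.
elim: w k G => [|j w IH] k G Gb /=.
  by case: k => [|k]; rewrite ?mul1r ?mul0r// cabs0.
rewrite (le_trans (cabsD _ _))// mulrDl lerD//.
  by case: k => [|k]; [rewrite cabs0 mul0r|exact: IH].
rewrite cabsM cabsX cabs_real -mulrA ler_wpM2l ?exprn_ge0//.
exact: IH.
Qed.

End WordGram.

Lemma der_map (R : realType) (q : R) (I J : eqType) (f : I -> J) (V : lmodType R[i]) i w
    (g : seq J -> V) : injective f ->
  der q (f i) (map f w) g = der q i w (fun v => g (map f v)).
Proof.
move=> fI; elim: w g => //= j w IH g; rewrite inj_eq// IH.
by [].
Qed.

Lemma qgram_map (R : realType) (q : R) (I J : eqType) (f : I -> J) u v :
  injective f -> qgram q (map f u) (map f v) = qgram q u v.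
Proof.
move=> fI; elim: v u => [|i v IH] u /=; first by case: u.
by rewrite der_map//; apply: der_ext => w _; exact: IH.
Qed.

Lemma unshuffle_scale (R : realType) (q : R) (I : eqType) (V : lmodType R[i]) k w
    (g : seq I -> seq I -> R[i]^o) (x : V) :
  unshuffle q k w (fun u v => g u v *: x) = unshuffle q k w g *: x.
Proof. by rewrite (rlin_unshuffle _ _ _ _ (rlin_scale x)). Qed.

Lemma der_ext_in (R : realType) (q : R) (I : eqType) (V : lmodType R[i]) (P : pred I)
    i w (g h : seq I -> V) : all P w ->
  (forall v, all P v -> (size v).+1 = size w -> g v = h v) -> der q i w g = der q i w h.
Proof.
elim: w g h => //= j w IH g h /andP[Pj Pw] gh; congr (_ + _ *: _).
  by case: eqP => // _; apply: gh.
by apply: IH => // v Pv sv; apply: gh; rewrite /= ?Pj// sv.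
Qed.

Lemma der_notin (R : realType) (q : R) (I : eqType) (V : lmodType R[i])
    i w (g : seq I -> V) : i \notin w -> der q i w g = 0.
Proof.
elim: w g => //= j w IH g; rewrite inE negb_or => /andP[/negPf -> iw].
by rewrite IH// scaler0 addr0.
Qed.

(** The matrix of the unshuffle functional, indexed by pairs of words. *)
Lemma unshuffle_expand (R : realType) (q : R) (I : finType) (V : lmodType R[i])
    k m w (G : seq I -> seq I -> V) : size w = (k + m)%N ->
  unshuffle q k w G = \sum_(p : k.-tuple I * m.-tuple I)
    unshuffle q k w (fun u v => ((u == p.1) && (v == p.2))%:R : R[i]^o) *: G p.1 p.2.
Proof.
move=> sw; under eq_bigr => p _ do rewrite -unshuffle_scale.
rewrite -unshuffle_sum; apply: unshuffle_ext => u v su sv.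
have {}sv : size v == m by rewrite -(eqn_add2l k) sv sw.
move/eqP: su => su.
rewrite (bigD1 (Tuple su, Tuple sv))//= !eqxx scale1r big1 ?addr0// => -[u' v'].
rewrite xpair_eqE /= => uv; case: eqP => [eu|_]; last by rewrite scale0r.
case: eqP => [ev|_]; last by rewrite scale0r.
case/negP: uv; apply/andP; split; apply/eqP/val_inj => //=.
Qed.

(** * The constants *)

Definition qbin_bound {R : realType} (r : R) : R := expR (r / (1 - r) ^+ 2).

Lemma qbin_bound_ge1 (R : realType) (r : R) : 0 <= r -> 1 <= qbin_bound r.
Proof.
move=> r0; rewrite -expR0 ler_expR.
by rewrite divr_ge0// sqr_ge0.
Qed.

(** The recursion gives the bound by the product over i <= k of 1 / (1 - r^i),
    and 1 / (1 - x) <= exp(x / (1 - r)) for x <= r makes this product at most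
    exp((r + r^2 + ...) / (1 - r)). *)
Lemma qbin_le (R : realType) (r : R) k n : 0 <= r -> r < 1 ->
  qbin r k n <= qbin_bound r.
Proof.
move=> r0 r1; have r1' : 0 < 1 - r by rewrite subr_gt0.
pose E k := expR ((1 - r)^-1 * \sum_(i < k) r ^+ i.+1).
have Eb m : E m <= qbin_bound r.
  rewrite ler_expR expr2 invfM mulrCA ler_wpM2l ?invr_ge0 ?(ltW r1')//.
  have : (1 - r) * (\sum_(i < m) r ^+ i.+1) = r - r ^+ m.+1.
    elim: m => [|m IH]; first by rewrite big_ord0; ring.
    by rewrite big_ord_recr /= mulrDr IH !exprS; ring.
  rewrite ler_pdivlMr// mulrC => ->.
  by rewrite gerBl exprn_ge0.
suff : qbin r k n <= E k by move/le_trans; apply.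
have E0 m : 0 <= E m by rewrite ltW// expR_gt0.
have E_ge1 m : 1 <= E m.
  rewrite -expR0 ler_expR mulr_ge0 ?invr_ge0 ?(ltW r1')//.
  by rewrite sumr_ge0// => i _; rewrite exprn_ge0.
have ES m : E m <= (1 - r ^+ m.+1) * E m.+1.
  rewrite /E big_ord_recr /= mulrDr expRD [X in _ <= _ * X]mulrC mulrA ler_peMl//.
  set x := r ^+ m.+1.
  have x0 : 0 <= x by rewrite exprn_ge0.
  have xr : x <= r by rewrite /x exprS ler_piMr// exprn_ile1// ltW.
  have h : 1 + (1 - r)^-1 * x <= expR ((1 - r)^-1 * x) by exact: expR_ge1Dx.
  have : (1 - x) * (1 + (1 - r)^-1 * x) <= (1 - x) * expR ((1 - r)^-1 * x).
    by rewrite ler_wpM2l// subr_ge0 (le_trans xr)// ltW.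
  apply: le_trans.
  have : x <= (1 - x) * ((1 - r)^-1 * x).
    rewrite mulrA ler_peMl// -[leLHS](mulfV (lt0r_neq0 r1')).
    by rewrite ler_wpM2r ?invr_ge0 ?(ltW r1')// lerD2l lerN2.
  by rewrite mulrDr mulr1; lra.
elim: n k => [|n IH] k /=.
  by case: k => [|k] /=; [exact: E_ge1|exact: E0].
case: k => [|k]; first by rewrite expr0 mul1r add0r IH.
apply: le_trans (lerD (IH k) (ler_wpM2l (exprn_ge0 _ r0) (IH k.+1))) _.
by have := ES k; lra.
Qed.

(** The first summand comes from the orthogonal parts of the T_k, the second one
    from their remainders. *)
Definition haagerup_const {R : realType} (r : R) : R :=
  2 * (qbin_bound r ^+ 2 + qbin_bound r ^+ 3 *
    ((qbin_bound r / (1 - r)) ^+ 2 / (1 - r)) / (1 - r)).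

Lemma haagerup_const_gt0 (R : realType) (r : R) : 0 <= r -> r < 1 ->
  0 < haagerup_const r.
Proof.
move=> r0 r1; have r1' : 0 < 1 - r by rewrite subr_gt0.
rewrite mulr_gt0// addr_gt0// !(divr_gt0, mulr_gt0, exprn_gt0)//;
  exact: expR_gt0.
Qed.

(** * Orthonormalisation *)

Section GramSchmidt.
Variables (R : realType) (E : lmodType R[i]) (dot : psd_form E).
Hypothesis dot_definite : forall x, sqn dot x = 0 -> x = 0.
Local Notation K := R[i].

Lemma gram_schmidt (T : finType) (g : T -> E) :
  exists p (f : 'I_p -> E),
  [/\ forall i j, dot (f i) (f j) = (i == j)%:R,
      forall u, g u = \sum_i dot (g u) (f i) *: f i &
      forall i, exists t : T -> K, f i = \sum_u t u *: g u].
Proof.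
suff [p [f [fo fg fs]]] : exists p (f : 'I_p -> E),
  [/\ forall i j, dot (f i) (f j) = (i == j)%:R,
      forall u, u \in enum T -> g u = \sum_i dot (g u) (f i) *: f i &
      forall i, exists t : T -> K, f i = \sum_u t u *: g u].
  by exists p, f; split=> // u; rewrite -fg// mem_enum.
elim: (enum T) => [|u0 s [p [f [fo fg fs]]]].
  by exists 0%N, (fun=> 0); split=> // -[].
pose y := g u0 - \sum_i dot (g u0) (f i) *: f i.
have yf j : dot y (f j) = 0.
  rewrite psdDl psdNl psd_suml (bigD1 j)//= big1.
    by rewrite addr0 psdZl fo eqxx mulr1 subrr.
  by move=> i /negPf ij; rewrite psdZl fo ij mulr0.
have [y0|y0] := eqVneq (sqn dot y) 0.
  exists p, f; split=> // u; rewrite inE => /orP[/eqP ->|]; last exact: fg.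
  by apply/eqP; rewrite -subr_eq0; apply/eqP/dot_definite.
pose c : K := ((nrm dot y)^-1)%:C%C.
pose f' (i : 'I_p.+1) := if unlift ord0 i is Some j then f j else c *: y.
have ny0 : nrm dot y != 0 by rewrite -sqrf_eq0 sqr_nrm.
have f'0 : f' ord0 = c *: y by rewrite /f' unlift_none.
have f'S j : f' (lift ord0 j) = f j by rewrite /f' liftK.
have cyy : c * c^* * dot y y = 1.
  rewrite mul_conj_cabs cabs_real real_normK ?num_real// sqnE.
  by rewrite -real_complexM -sqr_nrm -exprMn mulVf// expr1n.
have f'o : forall i j, dot (f' i) (f' j) = (i == j)%:R.
  move=> i j; case: (unliftP ord0 i) => [i' ->|->];
    case: (unliftP ord0 j) => [j' ->|->]; rewrite ?f'0 ?f'S.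
  - by rewrite fo (inj_eq lift_inj).
  - by rewrite psdZr psd_sym yf rmorph0 mulr0 eq_sym (negPf (neq_lift _ _)).
  - by rewrite psdZl yf mulr0 (negPf (neq_lift _ _)).
  - rewrite psdZl psdZr mulrA cyy eqxx //.
have fy j : dot (f j) y = 0 by rewrite psd_sym yf rmorph0.
have gu0 : g u0 = y + \sum_i dot (g u0) (f i) *: f i by rewrite subrK.
exists p.+1, f'; split=> //.
  move=> u; rewrite inE big_ord_recl f'0.
  under [X in _ -> _ = _ + X]eq_bigr => i _ do rewrite f'S.
  move=> /orP[/eqP ->|/fg e].
    rewrite [LHS]gu0; congr (_ + _).
    rewrite {1}gu0 psdDl psd_suml big1 => [|i _]; last first.
      by rewrite psdZl psdZr fy !mulr0.
    rewrite addr0 psdZr scalerA.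
    by rewrite [X in X *: _](_ : _ = 1) ?scale1r// -cyy; ring.
  suff -> : dot (g u) (c *: y) = 0 by rewrite scale0r add0r.
  by rewrite e psd_suml big1// => i _; rewrite psdZl psdZr fy !mulr0.
move=> i; case: (unliftP ord0 i) => [j ->|->]; first by rewrite f'S.
rewrite f'0.
pose t0 i := projT1 (cid (fs i)).
have t0E i' : f i' = \sum_u t0 i' u *: g u by rewrite {1}(projT2 (cid (fs i'))).
exists (fun u => c * ((u == u0)%:R - \sum_i dot (g u0) (f i) * t0 i u)).
rewrite /y scalerBr scaler_sumr.
under [RHS]eq_bigr => u _ do rewrite mulrBr scalerBl.
rewrite sumrB; congr (_ - _).
  rewrite (bigD1 u0)//= eqxx mulr1 big1 ?addr0// => u /negPf ->.
  by rewrite mulr0 scale0r.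
under eq_bigr => i' _ do rewrite t0E !scaler_sumr.
rewrite exchange_big; apply: eq_bigr => u _ /=.
rewrite mulr_sumr scaler_suml; apply: eq_bigr => i' _.
by rewrite -t0E !scalerA mulrA.
Qed.

Lemma parseval (T : finType) p (f : 'I_p -> E) (g : T -> E) :
  (forall i j, dot (f i) (f j) = (i == j)%:R) ->
  (forall u, g u = \sum_i dot (g u) (f i) *: f i) ->
  forall u v, \sum_i dot (g u) (f i) * (dot (g v) (f i))^* = dot (g u) (g v).
Proof.
move=> fo fg u v; rewrite [in RHS](fg v) psd_sumr.
by apply: eq_bigr => i _; rewrite psdZr mulrC.
Qed.

End GramSchmidt.

(** * Operators satisfying the q-commutation relations *)

Section Fock.
Variables (R : realType) (q : R) (E : lmodType R[i]) (dot : psd_form E).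
Variables (J : finType) (a as_ : J -> {linear E -> E}) (Om : E).
Local Notation K := R[i].
Local Notation qc := (q%:C%C : K).
Hypothesis q1 : `|q| < 1.
Hypothesis dot_definite : forall x, sqn dot x = 0 -> x = 0.
Hypothesis adj : forall j x y, dot (a j x) y = dot x (as_ j y).
Hypothesis comm : forall i j x,
  as_ i (a j x) = qc *: a j (as_ i x) + (if i == j then x else 0).
Hypothesis as_Om : forall j, as_ j Om = 0.
Hypothesis dot_Om : dot Om Om = 1.

(** Both products are in the order of w, so the adjoint of [cre w] is
    [ann (rev w)]. *)
Fixpoint cre (w : seq J) (x : E) : E := if w is j :: w' then a j (cre w' x) else x.
Fixpoint ann (w : seq J) (x : E) : E := if w is j :: w' then as_ j (ann w' x) else x.

Lemma cre_is_linear w : linear (cre w).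
Proof. by elim: w => //= j w IH c x y; rewrite IH linearP. Qed.
HB.instance Definition _ w := GRing.isLinear.Build K E E _ (cre w) (cre_is_linear w).

Lemma ann_is_linear w : linear (ann w).
Proof. by elim: w => //= j w IH c x y; rewrite IH linearP. Qed.
HB.instance Definition _ w := GRing.isLinear.Build K E E _ (ann w) (ann_is_linear w).

Lemma cre_cat u v x : cre (u ++ v) x = cre u (cre v x).
Proof. by elim: u => //= j u ->. Qed.

Lemma ann_cat u v x : ann (u ++ v) x = ann u (ann v x).
Proof. by elim: u => //= j u ->. Qed.

Lemma adj_r j x y : dot x (a j y) = dot (as_ j x) y.
Proof. by rewrite psd_sym adj -psd_sym. Qed.

Lemma dot_cre w x y : dot (cre w x) y = dot x (ann (rev w) y).
Proof.
by elim: w y => //= j w IH y; rewrite adj IH rev_cons -cats1 ann_cat.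
Qed.

Lemma dot_ann w x y : dot (ann w x) y = dot x (cre (rev w) y).
Proof. by rewrite psd_sym -{1}(revK w) -dot_cre -psd_sym. Qed.

(** The constant terms of the relations produce [der], and the last term is
    what remains of the annihilation operator after crossing all of w. *)
Lemma as_cre i w x :
  as_ i (cre w x) = der q i w (fun w' => cre w' x) + qc ^+ size w *: cre w (as_ i x).
Proof.
elim: w => [|j w IH] /=; first by rewrite expr0 scale1r add0r.
rewrite comm IH linearD linearZ /= scalerDr scalerA -exprS addrC addrA.
congr (_ + _ + _); congr (qc *: _).
by rewrite (@rlin_der _ q J E E (a j))//; split=> *; rewrite ?linearD ?linearZ.
Qed.

Definition ker (P : pred J) (x : E) := forall j, P j -> as_ j x = 0.

Lemma ker_Om P : ker P Om. Proof. by move=> j _; exact: as_Om. Qed.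

(** Vectors killed by the annihilation operators of the letters in P behave
    like vacuum vectors for the words in these letters. *)
Lemma dot_cre_ker (P : pred J) u v x y : ker P x -> ker P y ->
  all P u -> all P v -> dot (cre u x) (cre v y) = qgram q u v * dot x y.
Proof.
move=> kx ky; elim: v u => [|i v IH] u /= Pu Pv.
  case: u Pu => [|j u] /=; first by rewrite mul1r.
  by case/andP=> Pj _; rewrite adj ky// psd0r mul0r.
case/andP: Pv => Pi Pv; rewrite adj_r as_cre kx// linear0 scaler0 addr0.
rewrite (@rlin_der _ q J E K^o (fun z => dot z (cre v y))); last first.
  by split=> *; rewrite ?psdDl ?psdZl.
rewrite [RHS](rlin_der _ _ _ _ (rlin_mulr (dot x y))).
by apply: der_ext_in Pu _ => u' Pu' _; exact: IH.
Qed.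

Lemma dot_word u v : dot (cre u Om) (cre v Om) = qgram q u v.
Proof.
rewrite (@dot_cre_ker xpredT) ?dot_Om ?mulr1//; try exact: ker_Om.
  by apply/allP.
by apply/allP.
Qed.

Lemma as_cre_comm i w x : i \notin w ->
  as_ i (cre w x) = qc ^+ size w *: cre w (as_ i x).
Proof. by move=> iw; rewrite as_cre der_notin// add0r. Qed.

Lemma ann_cre_comm v w x : ~~ has (mem w) v ->
  ann v (cre w x) = qc ^+ (size v * size w) *: cre w (ann v x).
Proof.
elim: v => [|i v IH] /=; first by rewrite expr0 scale1r.
rewrite negb_or => /andP[iw vw]; rewrite IH// linearZ /= as_cre_comm//.
by rewrite scalerA -exprD mulSn addnC.
Qed.

Definition homog n (x : E) := exists c : n.-tuple J -> K, x = \sum_v c v *: cre v Om.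

(** Any large enough truncation must give x, so that finitely many vectors can
    be truncated at a common degree. *)
Definition fin (x : E) := exists2 f : nat -> E, forall n, homog n (f n) &
  exists N, forall M, (N <= M)%N -> x = \sum_(n < M) f n.

Lemma homog0 n : homog n 0.
Proof. by exists (fun=> 0); rewrite big1// => v _; rewrite scale0r. Qed.

Lemma homogD n x y : homog n x -> homog n y -> homog n (x + y).
Proof.
move=> [c ->] [d ->]; exists (fun v => c v + d v).
by rewrite -big_split /=; apply: eq_bigr => v _; rewrite scalerDl.
Qed.

Lemma homogZ n c x : homog n x -> homog n (c *: x).
Proof.
move=> [d ->]; exists (fun v => c * d v).
by rewrite scaler_sumr; apply: eq_bigr => v _; rewrite scalerA.
Qed.

Lemma homog_sum n (I : Type) (s : seq I) (P : pred I) (x : I -> E) :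
  (forall i, P i -> homog n (x i)) -> homog n (\sum_(i <- s | P i) x i).
Proof.
by move=> h; apply: big_ind => //; [exact: homog0|exact: homogD].
Qed.

Lemma homog_word n w : size w = n -> homog n (cre w Om).
Proof.
move=> /eqP sw; exists (fun v => (v == Tuple sw)%:R).
rewrite (bigD1 (Tuple sw))//= eqxx scale1r big1 ?addr0// => v /negPf ->.
by rewrite scale0r.
Qed.

Lemma homog_a n j x : homog n x -> homog n.+1 (a j x).
Proof.
move=> [c ->]; rewrite linear_sum; apply: homog_sum => v _.
by rewrite linearZ; apply/homogZ/(@homog_word _ (j :: v)); rewrite /= size_tuple.
Qed.

Lemma homog_as n j x : homog n.+1 x -> homog n (as_ j x).
Proof.
move=> [c ->]; rewrite linear_sum; apply: homog_sum => v _.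
rewrite linearZ /=; apply: homogZ; rewrite as_cre as_Om linear0 scaler0 addr0.
apply: der_ind => [|x' y'|c' x'|v' sv']; [exact: homog0|exact: homogD|exact: homogZ|].
by apply: homog_word; move: sv'; rewrite size_tuple => -[].
Qed.

Lemma homog_as0 j x : homog 0 x -> as_ j x = 0.
Proof.
move=> [c ->]; rewrite linear_sum big1// => v _.
by rewrite linearZ /= tuple0 /= as_Om scaler0.
Qed.

Lemma homog_orth n m x y : n <> m -> homog n x -> homog m y -> dot x y = 0.
Proof.
move=> nm [c ->] [d ->]; rewrite psd_suml big1// => u _.
rewrite psd_sumr big1// => v _; rewrite psdZl psdZr dot_word qgram_size ?mulr0//.
by rewrite !size_tuple; apply/eqP.
Qed.

Lemma fin_homog n x : homog n x -> fin x.
Proof.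
move=> hx; exists (fun m => if m == n then x else 0).
  by move=> m; case: eqP => [->//|_]; exact: homog0.
exists n.+1 => M nM; rewrite (bigD1 (Ordinal nM))//= eqxx big1 ?addr0// => i.
by rewrite -val_eqE /= => /negPf ->.
Qed.

Lemma fin0 : fin 0. Proof. exact: fin_homog (homog0 0). Qed.

Lemma finD x y : fin x -> fin y -> fin (x + y).
Proof.
move=> [f hf [N Nf]] [g hg [M Mg]]; exists (fun n => f n + g n).
  by move=> n; exact: homogD.
exists (maxn N M) => L; rewrite geq_max => /andP[NL ML].
by rewrite big_split -Nf// -Mg.
Qed.

Lemma finZ c x : fin x -> fin (c *: x).
Proof.
move=> [f hf [N Nf]]; exists (fun n => c *: f n); first by move=> n; exact: homogZ.
by exists N => M NM; rewrite -scaler_sumr -Nf.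
Qed.

Lemma fin_sum (I : Type) (s : seq I) (P : pred I) (x : I -> E) :
  (forall i, P i -> fin (x i)) -> fin (\sum_(i <- s | P i) x i).
Proof.
by move=> h; apply: big_ind => //; [exact: fin0|exact: finD].
Qed.

Lemma fin_a j x : fin x -> fin (a j x).
Proof.
move=> [f hf [N Nf]]; rewrite (Nf N)// linear_sum; apply: fin_sum => i _.
exact: fin_homog (homog_a _ (hf _)).
Qed.

Lemma fin_as j x : fin x -> fin (as_ j x).
Proof.
move=> [f hf [N Nf]]; rewrite (Nf N)// linear_sum; apply: fin_sum => -[i iN] _ /=.
case: i {iN} => [|i]; first by rewrite homog_as0//; exact: fin0.
exact: fin_homog (homog_as _ (hf _)).
Qed.

Lemma fin_cre w x : fin x -> fin (cre w x).
Proof. by move=> fx; elim: w => //= j w IH; exact: fin_a. Qed.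

Lemma fin_ann w x : fin x -> fin (ann w x).
Proof. by move=> fx; elim: w => //= j w IH; exact: fin_as. Qed.


(** * Boundedness of concatenation *)

(** With S the form on coefficient families that corresponds to the right-hand
    side and T the transpose of the unshuffle matrix D, [qgram_cat] says that
    S(T x, y) is the inner product of the concatenated vectors. So T is
    symmetric for S, and the growth of its powers is that of the powers of D,
    which have sup norm at most qbin_bound^j. *)
Lemma concat_homogeneous k m (x : k.-tuple J * m.-tuple J -> K) :
  sqn dot (\sum_p x p *: cre p.1 (cre p.2 Om)) <=
  qbin_bound `|q| * complex.Re (\sum_p \sum_p' x p * (x p')^* *
    (qgram q p.1 p'.1 * qgram q p.2 p'.2)).
Proof.
pose Q := (k.-tuple J * m.-tuple J)%type.
pose V : lmodType K := {ffun Q -> K^o}.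
have [r [f [fo fg _]]] := gram_schmidt dot_definite (fun u : k.-tuple J => cre u Om).
have pars := parseval fo fg.
(* The form S is realised as a sum of inner products of vectors, which makes it
   visibly positive. *)
pose Y i (z : V) := \sum_p ((z p : K) * dot (cre p.1 Om) (f i)) *: cre p.2 Om.
pose S (p p' : Q) : K := qgram q p.1 p'.1 * qgram q p.2 p'.2.
pose sf (y z : V) : K := \sum_i dot (Y i y) (Y i z).
have Ylin i c (y z : V) : Y i (c *: y + z) = c *: Y i y + Y i z.
  rewrite /Y scaler_sumr -big_split /=; apply: eq_bigr => p _.
  by rewrite !ffunE scalerA -scalerDl /GRing.scale /= mulrDl !mulrA.
have sf_lin c y z t : sf (c *: y + z) t = c * sf y t + sf z t.
  rewrite /sf mulr_sumr -big_split /=; apply: eq_bigr => i _.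
  by rewrite Ylin psdDl psdZl.
have sf_sym y z : sf z y = (sf y z)^*.
  by rewrite /sf rmorph_sum; apply: eq_bigr => i _; rewrite psd_sym.
have sf_ge0 y : 0 <= sf y y by apply: sumr_ge0 => i _; exact: psd_ge0.
pose s := PsdForm sf_lin sf_sym sf_ge0.
have sE y z : s y z = \sum_p \sum_p' y p * (z p')^* * S p p'.
  rewrite [LHS]/(sf y z) /sf /Y.
  under eq_bigr => i _ do rewrite psd_suml.
  rewrite exchange_big; apply: eq_bigr => p _ /=.
  under eq_bigr => i _ do rewrite psd_sumr.
  rewrite exchange_big; apply: eq_bigr => p' _ /=.
  rewrite /S -[qgram q p.1 p'.1]dot_word -pars mulr_suml mulr_sumr.
  apply: eq_bigr => i _; rewrite psdZl psdZr rmorphM /= dot_word.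
  by rewrite -!mulrA; congr (_ * _); ring.
pose D (p p' : Q) : K := unshuffle q k (p.1 ++ p.2)
   (fun u v => ((u == p'.1) && (v == p'.2))%:R : K^o).
pose T (y : V) : V := [ffun p' => \sum_p y p * D p p'].
pose Phi (y : V) := \sum_p (y p : K) *: cre p.1 (cre p.2 Om).
have DS p p' : \sum_p'' D p p'' * S p'' p' =
    dot (cre p.1 (cre p.2 Om)) (cre p'.1 (cre p'.2 Om)).
  rewrite -!cre_cat dot_word qgram_cat size_tuple (@unshuffle_expand _ _ _ _ _ m) //.
  by rewrite size_cat !size_tuple.
have sT y z : s (T y) z = dot (Phi y) (Phi z).
  rewrite sE /Phi psd_suml.
  transitivity (\sum_p'' \sum_p' \sum_p (y p * (z p')^* * (D p p'' * S p'' p'))).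
    apply: eq_bigr => p'' _; apply: eq_bigr => p' _; rewrite ffunE mulrAC mulr_suml.
    by rewrite mulr_suml; apply: eq_bigr => p _; ring.
  rewrite exchange_big /=; under eq_bigr => p' _ do rewrite exchange_big.
  rewrite exchange_big; apply: eq_bigr => p _ /=; rewrite psd_sumr.
  apply: eq_bigr => p' _; rewrite -mulr_sumr DS psdZl psdZr.
  by ring.
have Tsym y z : s (T y) z = s y (T z).
  by rewrite [RHS]psd_sym !sT -psd_sym.
pose C : R := qbin_bound `|q|.
have C0 : 0 < C by exact: expR_gt0.
have Dbound (h : Q -> K) b p : (forall p', cabs (h p') <= b) ->
    cabs (\sum_p' D p p' * h p') <= C * b.
  move=> hb; have b0 : 0 <= b by apply: le_trans (cabs_ge0 _) (hb p).
  rewrite (_ : \sum_p' _ = unshuffle q k (p.1 ++ p.2) (fun u v =>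
      \sum_(p' : Q) ((u == tval (fst p')) && (v == tval (snd p')))%:R *:
        (h p' : K^o))); last first.
    by rewrite unshuffle_sum; apply: eq_bigr => p' _; rewrite unshuffle_scale.
  apply: (le_trans (@unshuffle_bound _ _ _ _ _ _ b _)).
    move=> u v; have [[p' /andP[/eqP up /eqP vp]]|nex] :=
      pselect (exists p' : Q, (u == tval (fst p')) && (v == tval (snd p'))).
      rewrite (bigD1 p')//= up vp !eqxx scale1r big1 ?addr0// => p'' np.
      case: andP => [[/eqP e1 /eqP e2]|]; last by rewrite scale0r.
      case/eqP: np; case: (p') (p'') e1 e2 => [? ?] [? ?] /= e1 e2.
      by congr pair; apply/val_inj.
    rewrite big1 ?cabs0// => p' _; case: (boolP (_ && _)) => h1; last by rewrite scale0r.
    by case: nex; exists p'.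
  by rewrite ler_wpM2r// qbin_le.
pose xV : V := [ffun p => x p].
have PhiE : Phi xV = \sum_p x p *: cre p.1 (cre p.2 Om).
  by apply: eq_bigr => p _; rewrite ffunE.
have sxx : sqn s xV = complex.Re (\sum_p \sum_p' x p * (x p')^* * S p p').
  rewrite /sqn sE; congr complex.Re.
  by apply: eq_bigr => p _; apply: eq_bigr => p' _; rewrite !ffunE.
rewrite -PhiE -[X in _ <= _ * X]sxx {1}/sqn -sT.
apply: (@lax_symmetrization _ _ s T xV
  ((\sum_p cabs (x p)) * \sum_p \sum_p' cabs ((x p')^* * S p p')) C C0 Tsym) => j.
(* Pairing with h moves the powers of T to powers of D acting on h. *)
have iterT i : forall h b, (forall p, cabs (h p) <= b) ->
    cabs (\sum_p iter i T xV p * h p) <= (\sum_p cabs (x p)) * (C ^+ i * b).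
  elim: i => [|i IH] h b hb.
    rewrite mul1r mulr_suml; apply: le_trans (cabs_sum _ _ _) _.
    by apply: ler_sum => p _; rewrite ffunE cabsM ler_wpM2l ?cabs_ge0.
  rewrite exprSr -mulrA.
  rewrite (_ : \sum_p _ = \sum_p iter i T xV p * \sum_p' D p p' * h p').
    by apply: IH => p; exact: Dbound.
  rewrite iterS; under eq_bigr => p _ do rewrite ffunE mulr_suml.
  rewrite exchange_big; apply: eq_bigr => p _; rewrite mulr_sumr.
  by apply: eq_bigr => p' _; rewrite mulrA.
rewrite sE -mulrA [X in _ <= _ * X]mulrC.
have -> : \sum_p \sum_p' iter j T xV p * (xV p')^* * S p p' =
  \sum_p iter j T xV p * \sum_p' (x p')^* * S p p'.
  apply: eq_bigr => p _; rewrite mulr_sumr; apply: eq_bigr => p' _.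
  by rewrite ffunE -mulrA.
apply: iterT => p; apply: le_trans (cabs_sum _ _ _) _.
rewrite [leRHS](bigD1 p)//= lerDl sumr_ge0// => p' _.
by rewrite sumr_ge0// => p'' _; exact: cabs_ge0.
Qed.

Lemma homog_cre n w x : homog n x -> homog (size w + n) (cre w x).
Proof. by move=> hx; elim: w => //= j w IH; exact: homog_a. Qed.

(** Different degrees are orthogonal on both sides, so the homogeneous case
    suffices. *)
Lemma concat_tuples k (y : k.-tuple J -> E) : (forall u, fin (y u)) ->
  sqn dot (\sum_(u : k.-tuple J) cre u (y u)) <= qbin_bound `|q| *
    complex.Re (\sum_(u : k.-tuple J) \sum_(v : k.-tuple J)
      qgram q u v * dot (y u) (y v)).
Proof.
move=> fy.
have [F FP] : exists F : k.-tuple J -> nat -> E, forall u, (forall n, homog n (F u n)) /\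
    exists N, forall M, (N <= M)%N -> y u = \sum_(n < M) F u n.
  exists (fun u => sval (cid2 (fy u))) => u.
  by case: (cid2 (fy u)).
pose N u := sval (cid (FP u).2).
have NP u M : (N u <= M)%N -> y u = \sum_(n < M) F u n.
  by rewrite /N; case: (cid (FP u).2) => /= n h; exact: h.
pose M := \max_u N u.
have yE u : y u = \sum_(n < M) F u n by apply: NP; exact: leq_bigmax.
have hF u n : homog n (F u n) := (FP u).1 n.
have -> : \sum_(u : k.-tuple J) cre u (y u) =
    \sum_(n < M) \sum_(u : k.-tuple J) cre u (F u n).
  rewrite exchange_big; apply: eq_bigr => u _ /=.
  by rewrite {1}yE linear_sum.
rewrite sqn_pythagoras; last first.
  move=> n m nm; apply: (@homog_orth (k + n) (k + m)).
  - by move/addnI/val_inj/eqP; apply/negP.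
  - by apply: homog_sum => u _; rewrite -{1}(size_tuple u); exact: homog_cre.
  - by apply: homog_sum => u _; rewrite -{1}(size_tuple u); exact: homog_cre.
have -> : \sum_(u : k.-tuple J) \sum_(u' : k.-tuple J) qgram q u u' * dot (y u) (y u') =
   \sum_(n < M) \sum_(u : k.-tuple J) \sum_(u' : k.-tuple J)
     qgram q u u' * dot (F u n) (F u' n).
  rewrite [RHS]exchange_big; apply: eq_bigr => u _ /=.
  rewrite [RHS]exchange_big; apply: eq_bigr => u' _ /=.
  rewrite -mulr_sumr; congr (_ * _); rewrite {1}yE psd_suml.
  apply: eq_bigr => n _; rewrite {1}yE psd_sumr (bigD1 n)//= big1 ?addr0// => m mn.
  apply: homog_orth (hF u n) (hF u' m) => e.
  by case/eqP: mn; apply/val_inj; rewrite /= e.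
rewrite Re_sum mulr_sumr; apply: ler_sum => n _.
have [c cP] : exists c : k.-tuple J -> n.-tuple J -> K,
    forall u, F u n = \sum_v c u v *: cre v Om.
  exists (fun u => sval (cid (hF u n))) => u.
  by case: (cid (hF u n)).
have -> : \sum_(u : k.-tuple J) cre u (F u n) =
    \sum_(p : k.-tuple J * n.-tuple J) c p.1 p.2 *: cre p.1 (cre p.2 Om).
  rewrite -(pair_bigA _ (fun u v => c u v *: cre u (cre v Om))) /=.
  apply: eq_bigr => u _; rewrite cP linear_sum; apply: eq_bigr => v _.
  by rewrite linearZ.
have -> : \sum_(u : k.-tuple J) \sum_(u' : k.-tuple J) qgram q u u' * dot (F u n) (F u' n) =
  \sum_(p : k.-tuple J * n.-tuple J) \sum_p' c p.1 p.2 * (c p'.1 p'.2)^* *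
    (qgram q p.1 p'.1 * qgram q p.2 p'.2).
  rewrite -(pair_bigA _ (fun (u : k.-tuple J) (v : n.-tuple J) =>
    \sum_(p' : k.-tuple J * n.-tuple J) c u v * (c p'.1 p'.2)^* *
    (qgram q u p'.1 * qgram q v p'.2))) /=.
  apply: eq_bigr => u _.
  transitivity (\sum_(u' : k.-tuple J) \sum_(v : n.-tuple J) \sum_(v' : n.-tuple J)
      c u v * (c u' v')^* * (qgram q u u' * qgram q v v')).
    apply: eq_bigr => u' _; rewrite !cP psd_suml mulr_sumr.
    apply: eq_bigr => v _; rewrite psd_sumr mulr_sumr; apply: eq_bigr => v' _.
    by rewrite psdZl psdZr dot_word; ring.
  rewrite exchange_big; apply: eq_bigr => v _ /=.
  by rewrite (pair_bigA _ (fun (u' : k.-tuple J) (v' : n.-tuple J) =>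
    c u v * (c u' v')^* * (qgram q u u' * qgram q v v'))).
exact: concat_homogeneous.
Qed.

(** * Orthonormal families of creation polynomials *)

Section Rows.
Variables (I : finType) (iota : I -> J).
Hypothesis iota_inj : injective iota.
Local Notation cw u := (cre (map iota u)).
Local Notation kerI := (ker (mem (codom iota))).

Lemma all_iota u : all (mem (codom iota)) (map iota u).
Proof. by apply/allP => j /mapP[i _ ->]; exact: codom_f. Qed.

Lemma dot_cw_ker u v x y : kerI x -> kerI y ->
  dot (cw u x) (cw v y) = qgram q u v * dot x y.
Proof.
by move=> kx ky; rewrite (dot_cre_ker kx ky) ?all_iota// qgram_map.
Qed.

Definition rowop k (t : k.-tuple I -> K) (y : E) := \sum_(u : k.-tuple I) t u *: cw u y.

Lemma rowop_is_linear k (t : k.-tuple I -> K) : linear (rowop t).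
Proof.
move=> c x y; rewrite /rowop scaler_sumr -big_split /=; apply: eq_bigr => u _.
by rewrite linearP scalerDr !scalerA mulrC.
Qed.
HB.instance Definition _ k t :=
  GRing.isLinear.Build K E E _ (@rowop k t) (rowop_is_linear t).

Lemma dot_rowop_ker k l (t : k.-tuple I -> K) (s : l.-tuple I -> K) x y :
  kerI x -> kerI y ->
  dot (rowop t x) (rowop s y) = dot (rowop t Om) (rowop s Om) * dot x y.
Proof.
have kO : kerI Om by exact: ker_Om.
move=> kx ky; rewrite /rowop !psd_suml mulr_suml; apply: eq_bigr => u _.
rewrite !psd_sumr mulr_suml; apply: eq_bigr => v _.
by rewrite !psdZl !psdZr !dot_cw_ker// dot_Om mulr1 !mulrA.
Qed.

(** The sum over words in the smaller alphabet is regrouped according to their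
    images in the large one, where [concat_tuples] applies. *)
Lemma rowop_le (T : finType) k (t : T -> k.-tuple I -> K) (y : T -> E) :
  (forall i, fin (y i)) ->
  sqn dot (\sum_i rowop (t i) (y i)) <= qbin_bound `|q| *
    complex.Re (\sum_i \sum_j dot (rowop (t i) Om) (rowop (t j) Om) * dot (y i) (y j)).
Proof.
move=> fy; pose mp (u : k.-tuple I) : k.-tuple J := map_tuple iota u.
pose z (v : k.-tuple J) := \sum_(u | mp u == v) \sum_i t i u *: y i.
have -> : \sum_i rowop (t i) (y i) = \sum_(v : k.-tuple J) cre v (z v).
  transitivity (\sum_(u : k.-tuple I) cw u (\sum_i t i u *: y i)).
    rewrite /rowop exchange_big; apply: eq_bigr => u _ /=.
    by rewrite linear_sum; apply: eq_bigr => i _; rewrite linearZ.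
  rewrite (partition_big mp xpredT)//=; apply: eq_bigr => v _.
  by rewrite linear_sum; apply: eq_bigr => u /eqP <-.
apply: le_trans (concat_tuples _) _.
  by move=> v; apply: fin_sum => u _; apply: fin_sum => i _; exact: finZ.
pose w (u : k.-tuple I) := \sum_i t i u *: y i.
rewrite [X in _ * complex.Re X <= _](_ : _ =
    \sum_i \sum_j dot (rowop (t i) Om) (rowop (t j) Om) * dot (y i) (y j)) //.
transitivity (\sum_(u : k.-tuple I) \sum_(u' : k.-tuple I)
    qgram q u u' * dot (w u) (w u')).
  rewrite [RHS](partition_big mp xpredT)//=; apply: eq_bigr => v _.
  transitivity (\sum_(u | mp u == v) \sum_(v' : k.-tuple J)
      qgram q v v' * dot (w u) (z v')).
    rewrite exchange_big; apply: eq_bigr => v' _ /=.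
    by rewrite /z psd_suml mulr_sumr.
  apply: eq_bigr => u /eqP <-.
  rewrite [RHS](partition_big mp xpredT)//=; apply: eq_bigr => v' _.
  rewrite /z psd_sumr mulr_sumr; apply: eq_bigr => u' /eqP <-.
  by rewrite /= qgram_map.
transitivity (\sum_(u : k.-tuple I) \sum_(u' : k.-tuple I) \sum_i \sum_j
    t i u * (t j u')^* * qgram q u u' * dot (y i) (y j)).
  apply: eq_bigr => u _; apply: eq_bigr => u' _.
  rewrite /w psd_suml mulr_sumr; apply: eq_bigr => i _.
  rewrite psd_sumr mulr_sumr; apply: eq_bigr => j _.
  by rewrite psdZl psdZr; ring.
under eq_bigr => u _ do rewrite exchange_big.
rewrite exchange_big; apply: eq_bigr => i _ /=.
under eq_bigr => u _ do rewrite exchange_big.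
rewrite exchange_big; apply: eq_bigr => j _ /=.
rewrite /rowop psd_suml mulr_suml; apply: eq_bigr => u _.
rewrite psd_sumr mulr_suml; apply: eq_bigr => u' _.
rewrite psdZl psdZr dot_cw_ker; [|exact: ker_Om..].
by rewrite dot_Om; ring.
Qed.

(** By [rowop_le], a creation polynomial depends only on the vector that it
    creates from the vacuum. *)
Lemma rowop_null k (t : k.-tuple I -> K) y : rowop t Om = 0 -> fin y -> rowop t y = 0.
Proof.
move=> t0 fy; apply: dot_definite; apply/eqP; rewrite eq_le sqn_ge0 andbT.
have := @rowop_le unit k (fun=> t) (fun=> y) (fun=> fy).
have b1 (V : nmodType) (F : V) : \sum_(i : unit) F = F.
  by rewrite (bigD1 tt)//= big1 ?addr0// => -[].
by rewrite !b1 t0 psd0l mul0r mulr0.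
Qed.

(** Creation polynomials of degree k whose values at the vacuum are an
    orthonormal basis of the span of the words of length k. Gram-Schmidt
    produces such a family without predicting its size. *)
Record row k := Row {
  rdim : nat;
  rcoef : 'I_rdim -> k.-tuple I -> K;
  rorth : forall i j, dot (rowop (rcoef i) Om) (rowop (rcoef j) Om) = (i == j)%:R;
  rspan : forall u : k.-tuple I, cw u Om =
    \sum_i dot (cw u Om) (rowop (rcoef i) Om) *: rowop (rcoef i) Om }.

Lemma row_exists k : exists r : row k, True.
Proof.
have [p [f [fo fg fs]]] := gram_schmidt dot_definite (fun u : k.-tuple I => cw u Om).
pose t i := sval (cid (fs i)).
have tE i : f i = rowop (t i) Om by rewrite /t; case: (cid (fs i)).
unshelve eexists; first (exists p t => [i j|u]; first by rewrite -!tE); last by [].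
by rewrite {1}fg; apply: eq_bigr => i _; rewrite tE.
Qed.

Section OneRow.
Variables (k : nat) (r : row k).
Local Notation X i := (rowop (@rcoef k r i)).

Definition rcoord (u : k.-tuple I) (i : 'I_(rdim r)) : K := dot (cw u Om) (X i Om).

Lemma row_gram (u v : k.-tuple I) : \sum_i rcoord u i * (rcoord v i)^* = qgram q u v.
Proof.
rewrite (parseval (g := fun u : k.-tuple I => cw u Om) (@rorth _ r) (@rspan _ r)).
rewrite dot_cw_ker ?dot_Om ?mulr1//; exact: ker_Om.
Qed.

Lemma row_cre (u : k.-tuple I) y : fin y -> cw u y = \sum_i rcoord u i *: X i y.
Proof.
move=> fy; apply/eqP; rewrite -subr_eq0; apply/eqP.
pose t v := (v == u)%:R - \sum_i rcoord u i * rcoef i v.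
have tE x : rowop t x = cw u x - \sum_i rcoord u i *: X i x.
  rewrite /rowop /t; under eq_bigr => v _ do rewrite scalerBl.
  rewrite sumrB; congr (_ - _).
    by rewrite (bigD1 u)//= eqxx scale1r big1 ?addr0// => v /negPf ->; rewrite scale0r.
  under [RHS]eq_bigr => i _ do rewrite scaler_sumr.
  rewrite exchange_big; apply: eq_bigr => v _ /=.
  by rewrite scaler_suml; apply: eq_bigr => i _; rewrite scalerA.
rewrite -tE rowop_null// tE; apply/eqP; rewrite subr_eq0; apply/eqP; exact: rspan.
Qed.

(** A row of orthonormal creation polynomials is a bounded operator, uniformly
    in its length, its degree and the alphabet. *)
Lemma row_le y : (forall i, fin (y i)) ->
  sqn dot (\sum_i X i (y i)) <= qbin_bound `|q| * \sum_i sqn dot (y i).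
Proof.
move=> fy; apply: le_trans (rowop_le _ fy) _.
rewrite ler_pM2l ?expR_gt0// Re_sum; apply: ler_sum => i _.
rewrite (bigD1 i)//= rorth eqxx mul1r big1 ?addr0// => j /negPf ji.
by rewrite rorth eq_sym ji mul0r.
Qed.

Lemma row_ker i j x y : kerI x -> kerI y ->
  dot (X i x) (X j y) = (i == j)%:R * dot x y.
Proof. by move=> kx ky; rewrite dot_rowop_ker// rorth. Qed.

(** On vacuum-like vectors the row is even isometric. *)
Lemma row_ker_sqn y : (forall i, kerI (y i)) ->
  sqn dot (\sum_i X i (y i)) = \sum_i sqn dot (y i).
Proof.
move=> ky; rewrite sqn_pythagoras => [|i j /negPf ij]; last first.
  by rewrite row_ker// ij mul0r.
by apply: eq_bigr => i _; rewrite /sqn row_ker// eqxx mul1r.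
Qed.

Definition rowadj (i : 'I_(rdim r)) (x : E) :=
  \sum_u (rcoef i u)^* *: ann (rev (map iota u)) x.

Lemma rowadjP i x y : dot (X i x) y = dot x (rowadj i y).
Proof.
rewrite /rowop /rowadj psd_suml psd_sumr; apply: eq_bigr => u _.
by rewrite psdZl psdZr conjCK dot_cre.
Qed.

Lemma rowadj_is_linear i : linear (rowadj i).
Proof.
move=> c x y; rewrite /rowadj scaler_sumr -big_split /=; apply: eq_bigr => u _.
by rewrite linearP scalerDr !scalerA mulrC.
Qed.
HB.instance Definition _ i :=
  GRing.isLinear.Build K E E _ (rowadj i) (rowadj_is_linear i).

Lemma fin_rowadj i x : fin x -> fin (rowadj i x).
Proof. by move=> fx; apply: fin_sum => u _; apply/finZ/fin_ann. Qed.

(** The adjoint of the bounded row, a column, has the same bound. *)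
Lemma rowadj_le x : fin x ->
  \sum_i sqn dot (rowadj i x) <= qbin_bound `|q| * sqn dot x.
Proof.
move=> fx; set S := \sum_i _.
have S0 : 0 <= S by apply: sumr_ge0 => i _; exact: sqn_ge0.
have h1 : S = complex.Re (dot (\sum_i X i (rowadj i x)) x).
  by rewrite psd_suml Re_sum; apply: eq_bigr => i _; rewrite rowadjP.
have h2 : S ^+ 2 <= qbin_bound `|q| * S * sqn dot x.
  apply: (@le_trans _ _ (cabs (dot (\sum_i X i (rowadj i x)) x) ^+ 2)).
    by rewrite ler_pXn2r ?nnegrE ?cabs_ge0// h1 Re_le_cabs.
  apply: le_trans (psd_CS _ _ _) _; rewrite ler_wpM2r ?sqn_ge0//.
  by apply: row_le => i; exact: fin_rowadj.
have [S00|Sp] := eqVneq S 0.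
  by rewrite S00 mulr_ge0 ?sqn_ge0// ltW// expR_gt0.
have {}Sp : 0 < S by rewrite lt_neqAle eq_sym Sp.
by rewrite -(ler_pM2r Sp) -expr2 (le_trans h2)// mulrAC.
Qed.

End OneRow.

(** * Wold decomposition *)

(** The vectors with exactly l leading letters of the given alphabet: words of
    length l created on vectors killed by the annihilation operators of this
    alphabet. *)
Definition wold l (y : E) := exists2 x : l.-tuple I -> E,
  (forall u, fin (x u) /\ kerI (x u)) & y = \sum_(u : l.-tuple I) cw u (x u).

Lemma kerI0 : kerI 0. Proof. by move=> j _; exact: linear0. Qed.
Lemma kerID x y : kerI x -> kerI y -> kerI (x + y).
Proof. by move=> kx ky j Pj; rewrite linearD /= kx// ky// addr0. Qed.
Lemma kerIZ c x : kerI x -> kerI (c *: x).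
Proof. by move=> kx j Pj; rewrite linearZ /= kx// scaler0. Qed.
Lemma kerI_sum (T : Type) (s : seq T) (P : pred T) (x : T -> E) :
  (forall i, P i -> kerI (x i)) -> kerI (\sum_(i <- s | P i) x i).
Proof. by move=> h; apply: big_ind => //; [exact: kerI0|exact: kerID]. Qed.

Lemma wold0 l : wold l 0.
Proof.
exists (fun=> 0); first by split; [exact: fin0|exact: kerI0].
by rewrite big1// => u _; exact: linear0.
Qed.

Lemma woldD l x y : wold l x -> wold l y -> wold l (x + y).
Proof.
move=> [x' hx ->] [y' hy ->]; exists (fun u => x' u + y' u).
  move=> u; have [? ?] := hx u; have [? ?] := hy u.
  by split; [exact: finD|exact: kerID].
by rewrite -big_split /=; apply: eq_bigr => u _; rewrite linearD.
Qed.

Lemma woldZ l c x : wold l x -> wold l (c *: x).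
Proof.
move=> [x' hx ->]; exists (fun u => c *: x' u).
  by move=> u; have [? ?] := hx u; split; [exact: finZ|exact: kerIZ].
by rewrite scaler_sumr; apply: eq_bigr => u _; rewrite linearZ.
Qed.

Lemma wold_sum l (T : Type) (s : seq T) (P : pred T) (x : T -> E) :
  (forall i, P i -> wold l (x i)) -> wold l (\sum_(i <- s | P i) x i).
Proof. by move=> h; apply: big_ind => //; [exact: wold0|exact: woldD]. Qed.

Lemma wold_word l u x : size u = l -> fin x -> kerI x -> wold l (cw u x).
Proof.
move=> /eqP su fx kx; exists (fun v => (v == Tuple su)%:R *: x).
  by move=> v; split; [exact: finZ|exact: kerIZ].
rewrite (bigD1 (Tuple su))//= eqxx scale1r big1 ?addr0// => v /negPf ->.
by rewrite scale0r; exact: linear0.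
Qed.

Lemma wold_a l i x : wold l x -> wold l.+1 (a (iota i) x).
Proof.
move=> [x' hx ->]; rewrite linear_sum; apply: wold_sum => u _.
by apply: (@wold_word _ (i :: u)); rewrite /= ?size_tuple//; have [] := hx u.
Qed.

Lemma as_cw_ker i u x : kerI x ->
  as_ (iota i) (cw u x) = der q i u (fun v => cw v x).
Proof.
move=> kx; have e : as_ (iota i) x = 0 by apply: kx; exact: codom_f.
by rewrite as_cre e linear0 scaler0 addr0 der_map.
Qed.

Lemma wold_as l i x : wold l.+1 x -> wold l (as_ (iota i) x).
Proof.
move=> [x' hx ->]; rewrite linear_sum; apply: wold_sum => u _.
have [fx kx] := hx u; rewrite as_cw_ker//.
apply: der_ind => [|x1 x2|c x1|v sv];
  [exact: wold0|exact: woldD|exact: woldZ|].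
by apply: wold_word => //; move: sv; rewrite size_tuple => -[].
Qed.

Lemma wold0_ker x : wold 0 x -> kerI x.
Proof.
move=> [x' hx ->]; apply: kerI_sum => u _; rewrite tuple0 /=.
by have [] := hx [tuple].
Qed.

Lemma wold_fin l x : wold l x -> fin x.
Proof.
by move=> [x' hx ->]; apply: fin_sum => u _; apply/fin_cre; have [] := hx u.
Qed.

Lemma wold_orth l m x y : l != m -> wold l x -> wold m y -> dot x y = 0.
Proof.
move=> lm [x' hx ->] [y' hy ->]; rewrite psd_suml big1// => u _.
rewrite psd_sumr big1// => v _; have [_ kx] := hx u; have [_ ky] := hy v.
by rewrite dot_cw_ker// qgram_size ?mul0r// !size_tuple.
Qed.

Lemma wold_row l (r : row l) y : wold l y -> exists2 x : 'I_(rdim r) -> E,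
  (forall i, fin (x i) /\ kerI (x i)) & y = \sum_i rowop (@rcoef l r i) (x i).
Proof.
move=> [x' hx ->].
exists (fun i => \sum_(u : l.-tuple I) rcoord u i *: x' u) => [i|].
  split; first by apply: fin_sum => u _; apply/finZ; have [] := hx u.
  by apply: kerI_sum => u _; apply/kerIZ; have [] := hx u.
under [RHS]eq_bigr => i _ do rewrite linear_sum.
rewrite exchange_big; apply: eq_bigr => u _ /=.
rewrite (row_cre r); last by have [] := hx u.
by apply: eq_bigr => i _; rewrite linearZ.
Qed.

Lemma ann_wold u s y : wold (size u + s) y -> wold s (ann (map iota u) y).
Proof.
elim: u s => [|i u IH] s //= h; apply/wold_as/IH.
by rewrite addnS.
Qed.

Lemma ann_wold_lt u l y : (l < size u)%N -> wold l y -> ann (map iota u) y = 0.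
Proof.
elim: u => //= i u IH; rewrite ltnS leq_eqVlt => /orP[/eqP lu|lu] h; last first.
  by rewrite IH// linear0.
apply: wold0_ker; last exact: codom_f.
by apply: ann_wold; rewrite addn0 -lu.
Qed.

Lemma rowadj_wold m (r : row m) i s y : wold (m + s) y -> wold s (@rowadj m r i y).
Proof.
move=> h; apply: wold_sum => u _; apply: woldZ; rewrite -map_rev.
by apply: ann_wold; rewrite size_rev size_tuple.
Qed.

Lemma rowadj_wold_lt m (r : row m) i l y : (l < m)%N -> wold l y ->
  @rowadj m r i y = 0.
Proof.
move=> lm h; apply: big1 => u _; rewrite -map_rev (@ann_wold_lt _ l) ?scaler0//.
by rewrite size_rev size_tuple.
Qed.

Lemma homog_definite n z : homog n z ->
  (forall v : n.-tuple J, dot z (cre v Om) = 0) -> z = 0.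
Proof.
move=> [c zE] z0; apply: dot_definite; rewrite /sqn {2}zE psd_sumr big1// => v _.
by rewrite psdZr z0 mulr0.
Qed.

(** The orthogonal complement of the vectors a(j) x, with x homogeneous of
    degree n, in the homogeneous vectors of degree n + 1 is the part killed by
    the annihilation operators; the complement is found by Gram-Schmidt and the
    induction goes through the vectors x. *)
Lemma wold_homog n x : homog n x -> exists2 y : nat -> E, forall l, wold l (y l) &
  forall M, (n < M)%N -> x = \sum_(l < M) y l.
Proof.
elim: n x => [|n IH] x hx.
  exists (fun l => if l is 0%N then x else 0) => [[|l]|[|M] _//].
  - apply: (@wold_word _ [::]) => //; first exact: fin_homog hx.
    by move=> j _; exact: homog_as0.
  - exact: wold0.
  - by rewrite big_ord_recl big1 ?addr0.
have [p [f [fo fg fs]]] := gram_schmidt dot_definite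
  (fun t : I * n.-tuple J => a (iota t.1) (cre t.2 Om)).
pose pr := \sum_i dot x (f i) *: f i.
have prg i (v : n.-tuple J) : dot (x - pr) (a (iota i) (cre v Om)) = 0.
  rewrite (fg (i, v)) psd_sumr big1// => j _; rewrite psdZr psdDl psdNl.
  rewrite /pr psd_suml (bigD1 j)//= psdZl fo eqxx mulr1 big1 ?addr0 ?subrr ?mulr0//.
  by move=> k /negPf kj; rewrite psdZl fo kj mulr0.
have [c prE] : exists c : I -> n.-tuple J -> K,
    pr = \sum_i a (iota i) (\sum_v c i v *: cre v Om).
  pose t i := sval (cid (fs i)).
  exists (fun i v => \sum_k dot x (f k) * t k (i, v)).
  transitivity (\sum_k \sum_(s : I * n.-tuple J)
      (dot x (f k) * t k s) *: a (iota s.1) (cre s.2 Om)).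
    apply: eq_bigr => k _; rewrite /t; case: (cid (fs k)) => /= d ->.
    by rewrite scaler_sumr; apply: eq_bigr => s _; rewrite scalerA.
  transitivity (\sum_i \sum_(v : n.-tuple J)
      \sum_k (dot x (f k) * t k (i, v)) *: a (iota i) (cre v Om)).
    by rewrite exchange_big [RHS]pair_bigA /=; apply: eq_bigr => -[].
  apply: eq_bigr => i _; rewrite linear_sum; apply: eq_bigr => v _.
  by rewrite linearZ /= scaler_suml.
pose eta i := \sum_v c i v *: cre v Om.
have heta i : homog n (eta i) by exists (c i).
have hpr : homog n.+1 pr by rewrite prE; apply: homog_sum => i _; apply: homog_a (heta i).
have hx0 : homog n.+1 (x - pr) by apply: homogD hx _; rewrite -scaleN1r; apply: homogZ hpr.
have kx0 : kerI (x - pr).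
  move=> j /codomP[i ->]; apply: (@homog_definite n); first exact: homog_as.
  by move=> v; rewrite -adj_r prg.
pose Y i := sval (cid2 (IH _ (heta i))).
have YW i l : wold l (Y i l) by rewrite /Y; case: (cid2 (IH _ (heta i))).
have YE i M : (n < M)%N -> eta i = \sum_(l < M) Y i l.
  by rewrite /Y; case: (cid2 (IH _ (heta i))) => y _ /=; apply.
exists (fun l => if l is l'.+1 then \sum_i a (iota i) (Y i l') else x - pr).
  case=> [|l]; last by apply: wold_sum => i _; exact: wold_a.
  by apply: (@wold_word _ [::]) => //; exact: fin_homog hx0.
case=> // M nM; rewrite big_ord_recl /=.
rewrite [X in _ + X](_ : _ = pr) ?subrK// prE exchange_big.
apply: eq_bigr => i _; rewrite -/(eta i) (YE i M)// linear_sum.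
by apply: eq_bigr => l _; rewrite /bump.
Qed.

Lemma wold_decomposition x : fin x -> exists2 y : nat -> E, forall l, wold l (y l) &
  exists N, forall M, (N <= M)%N -> x = \sum_(l < M) y l.
Proof.
move=> [f hf [N Nf]].
pose Y n := sval (cid2 (wold_homog (hf n))).
have YW n l : wold l (Y n l) by rewrite /Y; case: (cid2 (wold_homog (hf n))).
have YE n M : (n < M)%N -> f n = \sum_(l < M) Y n l.
  by rewrite /Y; case: (cid2 (wold_homog (hf n))) => y _ /=; apply.
exists (fun l => \sum_(n < N) Y n l); first by move=> l; apply: wold_sum.
exists N => M NM; rewrite exchange_big (Nf N)//.
by apply: eq_bigr => n _; apply: YE; exact: leq_trans NM.
Qed.

End Rows.

(** * Near-orthogonality of two Wold decompositions *)

Lemma cabs_q : cabs qc = `|q|.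
Proof. exact: cabs_real. Qed.

Lemma geometric_sum_le n : \sum_(s < n) `|q| ^+ s <= (1 - `|q|)^-1.
Proof.
have q1' : 0 < 1 - `|q| by rewrite subr_gt0.
rewrite -[leRHS]mul1r ler_pdivlMr//.
have -> : (\sum_(s < n) `|q| ^+ s) * (1 - `|q|) = 1 - `|q| ^+ n.
  elim: n => [|n IH]; first by rewrite big_ord0 mul0r expr0 subrr.
  by rewrite big_ord_recr /= mulrDl IH exprSr; ring.
by rewrite gerBl exprn_ge0.
Qed.

Section TwoRows.
Variables (I : finType) (i1 i2 : I -> J).
Hypothesis i1_inj : injective i1.
Hypothesis i2_inj : injective i2.
Hypothesis i12 : forall i j, i1 i != i2 j.
Local Notation C := (qbin_bound `|q|).
Local Notation ker1 := (ker (mem (codom i1))).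

Lemma C_ge1 : 1 <= C. Proof. exact: qbin_bound_ge1. Qed.
Lemma C_gt0 : 0 < C. Proof. exact: expR_gt0. Qed.

Lemma rowadj_rowop l s (r : row i1 l) (t : s.-tuple I -> K) i x :
  @rowadj _ _ _ r i (rowop i2 t x) =
  qc ^+ (l * s) *: rowop i2 t (@rowadj _ _ _ r i x).
Proof.
transitivity (\sum_(u : s.-tuple I)
    t u *: (qc ^+ (l * s) *: cre (map i2 u) (@rowadj _ _ _ r i x))); last first.
  rewrite /rowop scaler_sumr; apply: eq_bigr => u _.
  by rewrite !scalerA mulrC.
rewrite linear_sum; apply: eq_bigr => u _; rewrite linearZ /=; congr (_ *: _).
rewrite /rowadj linear_sum scaler_sumr; apply: eq_bigr => v _.
rewrite ann_cre_comm; last first.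
  apply/hasPn => j; rewrite mem_rev => /mapP[i' _ ->]; apply/mapP => -[j' _ e].
  by have := i12 i' j'; rewrite e eqxx.
rewrite size_rev !size_map !size_tuple linearZ /= scalerA.
by rewrite [in RHS]linearZ /= scalerA mulrC.
Qed.

(** The l annihilations of y cross the s creations of z, with a factor q for
    each crossing; what remains are bounded rows and columns, and the norms of
    the coefficients are those of y and z because rows are isometric on
    vacuum-like vectors. *)
Lemma wold_pairing l s y z (r1 : row i1 l) (r2 : row i2 s) :
  wold i1 l y -> wold i2 s z ->
  cabs (dot y z) <= C * `|q| ^+ (l * s) * nrm dot y * nrm dot z.
Proof.
move=> /(wold_row i1_inj r1)[y' hy ->] /(wold_row i2_inj r2)[z' hz zE].
pose zeta i := \sum_j rowop i2 (@rcoef _ _ _ r2 j) (@rowadj _ _ _ r1 i (z' j)).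
have zadj i : @rowadj _ _ _ r1 i z = qc ^+ (l * s) *: zeta i.
  rewrite zE linear_sum /zeta scaler_sumr; apply: eq_bigr => j _ /=.
  exact: rowadj_rowop.
have zeta_le : \sum_i sqn dot (zeta i) <= C ^+ 2 * sqn dot z.
  have h i : sqn dot (zeta i) <= C * \sum_j sqn dot (@rowadj _ _ _ r1 i (z' j)).
    by apply: row_le => // j; apply: fin_rowadj; have [] := hz j.
  apply: le_trans (ler_sum _ (fun i _ => h i)) _.
  rewrite -mulr_sumr exchange_big expr2 -mulrA ler_pM2l ?C_gt0//.
  rewrite zE row_ker_sqn//; last by move=> j; have [] := hz j.
  rewrite mulr_sumr; apply: ler_sum => j _.
  by apply: rowadj_le => //; have [] := hz j.
set Y := \sum_i _.
have YE : sqn dot Y = \sum_i sqn dot (y' i).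
  by apply: row_ker_sqn => // i; have [] := hy i.
have dE : dot Y z = \sum_i dot (y' i) (@rowadj _ _ _ r1 i z).
  by rewrite /Y psd_suml; apply: eq_bigr => i _; rewrite rowadjP.
have C0 := C_gt0.
rewrite -(@ler_pXn2r _ 2) ?nnegrE ?cabs_ge0//; last first.
  by rewrite !mulr_ge0 ?nrm_ge0 ?exprn_ge0// ltW.
rewrite dE; apply: le_trans (psd_CS_sum _ _ _) _.
rewrite -YE !exprMn !sqr_nrm -!mulrA mulrCA mulrA.
under eq_bigr => i _ do rewrite zadj sqnZ cabsX cabs_q.
rewrite -mulr_sumr [X in _ <= X](_ : _ =
  sqn dot Y * ((`|q| ^+ (l * s)) ^+ 2 * (C ^+ 2 * sqn dot z))).
  by rewrite ler_wpM2l ?sqn_ge0// ler_wpM2l// exprn_ge0// exprn_ge0.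
by ring.
Qed.


Local Notation kappa := (C / (1 - `|q|)).

Lemma kappa_ge1 : 1 <= kappa.
Proof.
have q1' : 0 < 1 - `|q| by rewrite subr_gt0.
rewrite ler_pdivlMr// mul1r; apply: le_trans C_ge1.
by rewrite gerBl.
Qed.

(** Cauchy-Schwarz with the weight |q|^s shared as two square roots. *)
Lemma weighted_CS L (x : nat -> R) :
  (\sum_(s < L) `|q| ^+ s * x s) ^+ 2 <=
  (1 - `|q|)^-1 * \sum_(s < L) `|q| ^+ s * x s ^+ 2.
Proof.
pose t := Num.sqrt `|q|.
have t2 s : (t ^+ s) ^+ 2 = `|q| ^+ s by rewrite exprAC sqr_sqrtr.
have := cauchy_schwarz_sum (fun s : 'I_L => t ^+ s) (fun s : 'I_L => t ^+ s * x s).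
under eq_bigr => s _ do rewrite mulrA -expr2 t2.
under [X in _ <= X * _]eq_bigr => s _ do rewrite t2.
under [X in _ <= _ * X]eq_bigr => s _ do rewrite exprMn t2.
move/le_trans; apply; rewrite ler_wpM2r ?geometric_sum_le//.
by apply: sumr_ge0 => s _; rewrite mulr_ge0 ?sqr_ge0 ?exprn_ge0.
Qed.

(** The part w1 is the Wold component of degree 0 of w for the first alphabet,
    and w2 is the sum of the others. By [wold_pairing] the part w2 has a
    coefficient of order |q|^s against the component of degree s of w for the
    second alphabet. *)
Lemma wold_split L (z : nat -> E) (w : E) :
  (forall s, wold i2 s (z s)) -> w = \sum_(s < L) z s ->
  exists w1 w2, [/\ w = w1 + w2, fin w1, ker1 w1, sqn dot w1 <= sqn dot w &
    fin w2 /\ sqn dot w2 <= kappa ^+ 2 / (1 - `|q|) *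
       \sum_(s < L) `|q| ^+ s * sqn dot (z s)].
Proof.
move=> hz wE.
have fw : fin w by rewrite wE; apply: fin_sum => s _; exact: wold_fin (hz s).
have [y hy [M0 yE]] := wold_decomposition i1 fw.
have {yE} := yE M0.+1 (leqnSn _); rewrite big_ord_recl /= => yE.
set w2 : E := \sum_(i < M0) _ in yE.
have ko : ker1 (y 0%N) by exact: wold0_ker (hy 0%N).
have fw2 : fin w2 by apply: fin_sum => l _; exact: wold_fin (hy _).
have o12 : dot w2 (y 0%N) = 0.
  rewrite psd_suml big1// => l _.
  exact: (wold_orth i1_inj (_ : bump 0 l != 0%N) (hy _) (hy _)).
have o21 : dot (y 0%N) w2 = 0 by rewrite psd_sym o12 rmorph0.
have sw : sqn dot w = sqn dot (y 0%N) + sqn dot w2.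
  by rewrite yE /sqn psdDl !psdDr o12 o21 addr0 add0r ReD.
exists (y 0%N), w2; split=> //; first exact: wold_fin (hy _).
  by rewrite sw lerDl sqn_ge0.
split=> //.
have q0 : 0 <= `|q| by [].
have C0 := C_gt0; have k0 : 0 <= kappa by apply: le_trans kappa_ge1.
have ynrm (l : 'I_M0) : nrm dot (y (bump 0 l)) <= nrm dot w2.
  rewrite ler_sqrt ?sqn_ge0// /w2 sqn_pythagoras; last first.
    move=> i j ij; apply: (wold_orth i1_inj _ (hy _) (hy _)).
    by rewrite /bump !add1n eqSS.
  by rewrite (bigD1 l)//= lerDl sumr_ge0// => i _; exact: sqn_ge0.
(* For s = 0 the factor |q|^(l s) gives no decay in l, but w2 need not be
   decomposed; for s > 0 and l > 0 one has l s >= (l - 1) + s, which leaves a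
   geometric sum over l. *)
have step s : cabs (dot w2 (z s)) <= kappa * nrm dot w2 * (`|q| ^+ s * nrm dot (z s)).
  case: s => [|s].
    apply: le_trans (psd_CS_nrm _ _ _) _.
    rewrite expr0 mul1r -mulrA ler_peMl ?kappa_ge1//.
    by rewrite mulr_ge0 ?nrm_ge0.
  rewrite psd_suml; apply: le_trans (cabs_sum _ _ _) _.
  apply: (@le_trans _ _ (\sum_(l < M0) `|q| ^+ l *
     (C * nrm dot w2 * (`|q| ^+ s.+1 * nrm dot (z s.+1))))); last first.
    rewrite -mulr_suml [X in _ <= X](_ : _ =
      (1 - `|q|)^-1 * (C * nrm dot w2 * (`|q| ^+ s.+1 * nrm dot (z s.+1)))).
      rewrite ler_wpM2r ?geometric_sum_le//.
      by rewrite !mulr_ge0 ?nrm_ge0 ?exprn_ge0// ltW.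
    by ring.
  apply: ler_sum => l _.
  have [r1 _] := row_exists i1 (bump 0 l); have [r2 _] := row_exists i2 s.+1.
  apply: le_trans (wold_pairing r1 r2 (hy _) (hz _)) _.
  rewrite [X in _ <= X](_ : _ =
      C * (`|q| ^+ (l + s.+1)) * nrm dot w2 * nrm dot (z s.+1)); last first.
    by rewrite exprD; ring.
  rewrite ler_wpM2r ?nrm_ge0// ler_pM ?nrm_ge0//.
    by rewrite mulr_ge0 ?exprn_ge0// ltW.
  rewrite ler_pM2l// ler_wiXn2l ?(ltW q1)//.
  by rewrite /bump add1n; lia.
set S := \sum_(s < L) `|q| ^+ s * nrm dot (z s).
have S0 : 0 <= S by apply: sumr_ge0 => s _; rewrite mulr_ge0 ?nrm_ge0 ?exprn_ge0.
have b1 : sqn dot w2 <= kappa * nrm dot w2 * S.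
  have -> : sqn dot w2 = complex.Re (dot w2 w).
    by rewrite yE psdDr o12 add0r.
  rewrite wE psd_sumr Re_sum mulr_sumr; apply: ler_sum => s _.
  exact: le_trans (Re_le_cabs _) (step s).
have b2 : nrm dot w2 <= kappa * S.
  have [n0|n0] := eqVneq (nrm dot w2) 0; first by rewrite n0 mulr_ge0.
  have np : 0 < nrm dot w2 by rewrite lt_neqAle eq_sym n0 nrm_ge0.
  by rewrite -(ler_pM2l np) -expr2 sqr_nrm mulrCA mulrA.
rewrite -sqr_nrm; apply: (@le_trans _ _ ((kappa * S) ^+ 2)).
  by apply: lerXn2r => //; rewrite nnegrE ?nrm_ge0// mulr_ge0.
rewrite exprMn -mulrA ler_wpM2l ?sqr_ge0//.
apply: le_trans (weighted_CS L (fun s => nrm dot (z s))) _.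
rewrite ler_wpM2l ?invr_ge0 ?subr_ge0 ?(ltW q1)//.
by apply: ler_sum => s _; rewrite sqr_nrm.
Qed.

(** * Normal ordering of circular words *)

Definition circ i x : E := a (i1 i) x + as_ (i2 i) x.
Fixpoint circ_word (w : seq I) x : E :=
  if w is i :: w' then circ i (circ_word w' x) else x.

Lemma as2_cre1 i w x :
  as_ (i2 i) (cre (map i1 w) x) = qc ^+ size w *: cre (map i1 w) (as_ (i2 i) x).
Proof.
rewrite as_cre_comm ?size_map//; apply/mapP => -[j _ e].
by have := i12 j i; rewrite e eqxx.
Qed.

(** Each new letter is either created, in front, or annihilated, and then it
    crosses the k letters already created; this is the recursion that defines
    [unshuffle]. *)
Lemma circ_word_expand w x : circ_word w x = \sum_(k < (size w).+1)
  unshuffle q k w (fun u v => cre (map i1 u) (ann (map i2 v) x)).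
Proof.
elim: w => [|i w IH]; first by rewrite big_ord_recl big_ord0 addr0.
rewrite [LHS]/(circ i (circ_word w x)) IH /circ.
under [RHS]eq_bigr => k _ do rewrite /=.
rewrite big_split /=; congr (_ + _).
  rewrite [RHS]big_ord_recl /= add0r linear_sum; apply: eq_bigr => k _.
  rewrite (rlin_unshuffle _ _ _ _ (phi := a (i1 i)))//.
  by split=> *; rewrite ?linearD ?linearZ.
rewrite [RHS]big_ord_recr /= [X in _ + _ *: X]unshuffle_big// scaler0 addr0.
rewrite linear_sum; apply: eq_bigr => k _.
rewrite (rlin_unshuffle _ _ _ _ (phi := as_ (i2 i))); last first.
  by split=> *; rewrite ?linearD ?linearZ.
rewrite (rlin_unshuffle _ _ _ _ (phi := fun y : E => qc ^+ k *: y)); last first.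
  by split=> *; rewrite ?scalerDr// !scalerA mulrC.
by apply: unshuffle_ext => u v su _; rewrite as2_cre1 su.
Qed.

Lemma circ_word_Om w : circ_word w Om = cre (map i1 w) Om.
Proof. by elim: w => //= i w ->; rewrite /circ as2_cre1 as_Om linear0 scaler0 addr0. Qed.

(** * Hilbert-Schmidt bound for the normally ordered kernels *)

Section Coefficients.
Variables (alpha : seq I -> K) (n k m : nat).
Hypothesis nkm : n = (k + m)%N.
Local Notation Q := (k.-tuple I * m.-tuple I)%type.
Local Notation vec := (\sum_(w : n.-tuple I) alpha w *: cre (map i1 w) Om).

Definition unshuffle_coeff (p : Q) : K := \sum_(w : n.-tuple I) alpha w *
  unshuffle q k w (fun u v => ((u == tval p.1) && (v == tval p.2))%:R : K^o).

Lemma unshuffle_coeffP (V : lmodType K) (G : seq I -> seq I -> V) :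
  \sum_(w : n.-tuple I) alpha w *: unshuffle q k w G =
  \sum_(p : Q) unshuffle_coeff p *: G p.1 p.2.
Proof.
under eq_bigr => w _ do rewrite (@unshuffle_expand _ _ _ _ k m) ?size_tuple// scaler_sumr.
rewrite exchange_big; apply: eq_bigr => p _ /=.
by rewrite /unshuffle_coeff scaler_suml; apply: eq_bigr => w _; rewrite scalerA.
Qed.

Variables (r1 : row i1 k) (r2 : row i2 m).
Local Notation X i := (rowop i1 (rcoef (r := r1) i)).
Local Notation c1 := (@rcoord _ _ _ r1).
Local Notation c2 := (@rcoord _ _ _ r2).

(** The matrix of T_k from the column of degree m in the second alphabet to the
    row of degree k in the first one; the reversal and the conjugation come from
    writing annihilation words as adjoints of creation words. *)
Definition kernel_coeff (i : 'I_(rdim r1)) (j : 'I_(rdim r2)) : K :=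
  \sum_(p : Q) unshuffle_coeff p * (c1 p.1 i * (c2 (rev_tuple p.2) j)^*).

(** The unshuffled vector, with only its left half expressed in the orthonormal
    family; the right half is kept as a vector. *)
Definition half_contraction (i : 'I_(rdim r1)) : E :=
  \sum_(p : Q) (unshuffle_coeff p * c1 p.1 i) *: cre (map i1 p.2) Om.

(* The squared norm of the unshuffled vector in the tensor product of the two
   q-inner product spaces. *)
Let H : K := \sum_(p : Q) \sum_(p' : Q) unshuffle_coeff p * (unshuffle_coeff p')^* *
  (qgram q p.1 p'.1 * qgram q p.2 p'.2).

Lemma dot_word1 (u v : seq I) : dot (cre (map i1 u) Om) (cre (map i1 v) Om) = qgram q u v.
Proof. by rewrite (dot_cw_ker i1_inj) ?dot_Om ?mulr1//; exact: ker_Om. Qed.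

Lemma qgram_sym (u v : seq I) : qgram q u v = qgram q v u :> K.
Proof. by rewrite -dot_word1 psd_sym dot_word1 qgram_real. Qed.

Lemma kernel_coeff_H : (\sum_i \sum_j cabs (kernel_coeff i j) ^+ 2)%:C%C = H.
Proof.
transitivity (\sum_i \sum_j \sum_(p : Q) \sum_(p' : Q)
   unshuffle_coeff p * (unshuffle_coeff p')^* *
   ((c1 p.1 i * (c1 p'.1 i)^*) * (c2 (rev_tuple p'.2) j * (c2 (rev_tuple p.2) j)^*))).
  rewrite rmorph_sum; apply: eq_bigr => i _; rewrite rmorph_sum; apply: eq_bigr => j _.
  rewrite /= -mul_conj_cabs /kernel_coeff rmorph_sum mulr_suml; apply: eq_bigr => p _.
  rewrite mulr_sumr; apply: eq_bigr => p' _; rewrite /= !rmorphM /= conjCK.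
  by ring.
under eq_bigr => i _ do rewrite exchange_big.
rewrite exchange_big; apply: eq_bigr => p _ /=.
under eq_bigr => i _ do rewrite exchange_big.
rewrite exchange_big; apply: eq_bigr => p' _ /=.
under eq_bigr => i _ do rewrite -mulr_sumr -mulr_sumr.
rewrite -mulr_sumr -mulr_suml !row_gram//.
by rewrite /= qgram_rev (qgram_sym p'.2).
Qed.

Lemma half_contraction_H : (\sum_i sqn dot (half_contraction i))%:C%C = H.
Proof.
transitivity (\sum_i \sum_(p : Q) \sum_(p' : Q) unshuffle_coeff p * (unshuffle_coeff p')^* *
   ((c1 p.1 i * (c1 p'.1 i)^*) * qgram q p.2 p'.2)).
  rewrite rmorph_sum; apply: eq_bigr => i _.
  rewrite /= -sqnE /half_contraction psd_suml; apply: eq_bigr => p _.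
  rewrite psd_sumr; apply: eq_bigr => p' _; rewrite psdZl psdZr dot_word1 rmorphM /=.
  by ring.
rewrite exchange_big; apply: eq_bigr => p _ /=.
rewrite exchange_big; apply: eq_bigr => p' _ /=.
by rewrite -mulr_sumr -mulr_suml row_gram//.
Qed.

Lemma fin_Om : fin Om.
Proof. by apply: (@fin_homog 0); apply: (@homog_word _ [::]). Qed.

(** Unshuffling is the adjoint of concatenation: pairing T Omega with the
    concatenation of its unshuffles gives the squared norm of the latter. *)
Lemma dot_vec_half_contraction : dot vec (\sum_i X i (half_contraction i)) = H.
Proof.
have -> : \sum_i X i (half_contraction i) =
    \sum_(p : Q) unshuffle_coeff p *: cre (map i1 p.1) (cre (map i1 p.2) Om).
  under eq_bigr => i _ do rewrite /half_contraction linear_sum.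
  rewrite exchange_big; apply: eq_bigr => p _ /=.
  rewrite (row_cre i1_inj r1); last by apply/fin_cre/fin_Om.
  by rewrite scaler_sumr; apply: eq_bigr => i _; rewrite linearZ /= scalerA.
rewrite psd_sumr /H exchange_big; apply: eq_bigr => p' _ /=.
rewrite psdZr -cre_cat -map_cat psd_suml.
have := unshuffle_coeffP (fun u v => qgram q u p'.1 * qgram q v p'.2 : K^o).
rewrite (eq_bigr (fun w : n.-tuple I => dot (alpha w *: cre (map i1 w) Om)
  (cre (map i1 (p'.1 ++ p'.2)) Om))) => [->|w _].
  rewrite mulr_sumr; apply: eq_bigr => p _.
  by rewrite /GRing.scale /=; ring.
rewrite psdZl dot_word1 qgram_cat size_tuple //.
Qed.

(** The adjoint of concatenation has the same norm as concatenation itself. *)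
Lemma kernel_coeff_le : \sum_i \sum_j cabs (kernel_coeff i j) ^+ 2 <= C * sqn dot vec.
Proof.
have bz : \sum_i \sum_j cabs (kernel_coeff i j) ^+ 2 = \sum_i sqn dot (half_contraction i).
  by apply: (@complexI R); rewrite kernel_coeff_H half_contraction_H.
rewrite bz; set S := \sum_i _.
have S0 : 0 <= S by apply: sumr_ge0 => i _; exact: sqn_ge0.
have h : S ^+ 2 <= sqn dot vec * (C * S).
  apply: (@le_trans _ _ (cabs (dot vec (\sum_i X i (half_contraction i))) ^+ 2)).
    by rewrite dot_vec_half_contraction -half_contraction_H cabs_real ger0_norm.
  apply: le_trans (psd_CS _ _ _) _; rewrite ler_wpM2l ?sqn_ge0//.
  apply: row_le => // i; apply: fin_sum => p _; apply/finZ/fin_cre/fin_Om.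
have [S00|Sp] := eqVneq S 0.
  by rewrite S00 mulr_ge0 ?sqn_ge0// ltW// C_gt0.
have {}Sp : 0 < S by rewrite lt_neqAle eq_sym Sp.
by rewrite -(ler_pM2r Sp) -expr2 (le_trans h)// mulrCA mulrA.
Qed.

Lemma ann_row (v : m.-tuple I) x : fin x ->
  ann (map i2 v) x = \sum_j (c2 (rev_tuple v) j)^* *: @rowadj _ _ _ r2 j x.
Proof.
move=> fx; apply/eqP; rewrite -subr_eq0; apply/eqP.
set d := _ - _; have fd : fin d.
  apply: finD; first exact: fin_ann.
  rewrite -scaleN1r; apply/finZ/fin_sum => j _; apply/finZ; exact: fin_rowadj.
apply: dot_definite; rewrite /sqn {1}/d psdDl psdNl dot_ann -map_rev.
rewrite (row_cre i2_inj r2 (rev_tuple v))//= psd_sumr psd_suml.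
rewrite -sumrB big1// => j _.
rewrite psdZl psdZr [Z in _ - _ * Z]psd_sym -rowadjP -psd_sym.
by rewrite subrr.
Qed.

Lemma degree_part x : fin x ->
  \sum_(w : n.-tuple I) alpha w *: unshuffle q k w
     (fun u v => cre (map i1 u) (ann (map i2 v) x)) =
  \sum_i X i (\sum_j kernel_coeff i j *: @rowadj _ _ _ r2 j x).
Proof.
move=> fx; rewrite unshuffle_coeffP.
transitivity (\sum_(p : Q) \sum_i \sum_j
   (unshuffle_coeff p * (c1 p.1 i * (c2 (rev_tuple p.2) j)^*)) *:
     X i (@rowadj _ _ _ r2 j x)).
  apply: eq_bigr => p _; rewrite (row_cre i1_inj r1); last exact: fin_ann.
  rewrite scaler_sumr; apply: eq_bigr => i _.
  rewrite ann_row// scalerA [Z in _ *: Z = _]linear_sum scaler_sumr.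
  by apply: eq_bigr => j _; rewrite linearZ /= !scalerA mulrA.
rewrite exchange_big; apply: eq_bigr => i _ /=.
rewrite [RHS]linear_sum exchange_big; apply: eq_bigr => j _ /=.
by rewrite linearZ /= /kernel_coeff scaler_suml.
Qed.

End Coefficients.

(** * The estimate on finite vectors *)

Local Notation C2 := (kappa ^+ 2 / (1 - `|q|)).

Lemma C2_ge0 : 0 <= C2.
Proof. by rewrite divr_ge0 ?sqr_ge0// subr_ge0 ltW. Qed.

Lemma lincomb_le (T1 T2 : finType) (b : T1 -> T2 -> K) (w : T2 -> E) :
  \sum_i sqn dot (\sum_j b i j *: w j) <=
  (\sum_i \sum_j cabs (b i j) ^+ 2) * \sum_j sqn dot (w j).
Proof. by rewrite mulr_suml; apply: ler_sum => i _; exact: sqn_lincomb. Qed.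

(** The operator T_k is the composition of a bounded column, a Hilbert-Schmidt
    matrix and a bounded row; each entry of the column is split by [wold_split]
    before the row is applied. The part P keeps track of the Wold degree k, and
    the part Q of the Wold components of x with at least m leading barred
    letters. *)
Lemma degree_split (alpha : seq I -> K) n k m x (y : nat -> E) L :
  n = (k + m)%N -> fin x -> (forall l, wold i2 l (y l)) ->
  (forall M, (L <= M)%N -> x = \sum_(l < M) y l) ->
  let vec := \sum_(w : n.-tuple I) alpha w *: cre (map i1 w) Om in
  exists P Q, [/\ \sum_(w : n.-tuple I) alpha w *: unshuffle q k w
       (fun u v => cre (map i1 u) (ann (map i2 v) x)) = P + Q,
    wold i1 k P, sqn dot P <= C ^+ 2 * sqn dot vec * sqn dot x &
    sqn dot Q <= C ^+ 3 * C2 * sqn dot vec *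
      \sum_(s < L) `|q| ^+ s * sqn dot (y (m + s)%N)].
Proof.
move=> nkm fx hy yE vec.
have [r1 _] := row_exists i1 k; have [r2 _] := row_exists i2 m.
pose o j := @rowadj _ _ _ r2 j x.
have fo j : fin (o j) by exact: fin_rowadj.
have oE j : o j = \sum_(s < L) @rowadj _ _ _ r2 j (y (m + s)%N).
  rewrite /o (yE (m + L)%N) ?leq_addl// linear_sum big_split_ord /=.
  by rewrite big1 ?add0r// => l _; exact: (rowadj_wold_lt i2_inj _ (ltn_ord l) (hy _)).
have ow j s : wold i2 s (@rowadj _ _ _ r2 j (y (m + s)%N)) by exact: rowadj_wold.
have sp j := wold_split (ow j) (oE j).
have [w1] := choice sp => /choice[w2 wP] {sp}.
pose b := @kernel_coeff alpha n k m r1 r2.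
have C0 := C_gt0; have C20 := C2_ge0.
have bN : \sum_i \sum_j cabs (b i j) ^+ 2 <= C * sqn dot vec by exact: kernel_coeff_le.
pose z1 i := \sum_j b i j *: w1 j; pose z2 i := \sum_j b i j *: w2 j.
have f1 i : fin (z1 i) by apply: fin_sum => j _; apply: finZ; have [] := wP j.
have f2 i : fin (z2 i) by apply: fin_sum => j _; apply: finZ; have [? ? ? ? []] := wP j.
have k1 i : ker1 (z1 i) by apply: kerI_sum => j _; apply: kerIZ; have [] := wP j.
exists (\sum_i rowop i1 (rcoef (r := r1) i) (z1 i)),
  (\sum_i rowop i1 (rcoef (r := r1) i) (z2 i)).
split.
- rewrite (degree_part _ nkm r1 r2 fx) -big_split /=; apply: eq_bigr => i _.
  rewrite -linearD; congr (rowop _ _ _).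
  rewrite /z1 /z2 -big_split /=; apply: eq_bigr => j _.
  by rewrite -scalerDr; congr (_ *: _); have [] := wP j.
- apply: wold_sum => i _; apply: wold_sum => u _; apply: woldZ.
  by apply: wold_word => //; rewrite size_tuple.
- rewrite row_ker_sqn//; apply: le_trans (lincomb_le b w1) _.
  rewrite (_ : _ * _ * _ = (C * sqn dot vec) * (C * sqn dot x)); last by ring.
  rewrite ler_pM//.
  + by apply: sumr_ge0 => i _; apply: sumr_ge0 => j _; rewrite sqr_ge0.
  + by apply: sumr_ge0 => j _; exact: sqn_ge0.
  + apply: (@le_trans _ _ (\sum_j sqn dot (o j))); last exact: rowadj_le.
    by apply: ler_sum => j _; have [] := wP j.
- apply: le_trans (row_le i1_inj f2) _.
  rewrite (_ : _ * _ * _ * _ = C * ((C * sqn dot vec) * (C2 * (C *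
    \sum_(s < L) `|q| ^+ s * sqn dot (y (m + s)%N))))); last by ring.
  rewrite ler_pM2l//; apply: le_trans (lincomb_le b w2) _.
  rewrite ler_pM//.
  + by apply: sumr_ge0 => i _; apply: sumr_ge0 => j _; rewrite sqr_ge0.
  + by apply: sumr_ge0 => j _; exact: sqn_ge0.
  apply: (@le_trans _ _ (\sum_j C2 *
       \sum_(s < L) `|q| ^+ s * sqn dot (@rowadj _ _ _ r2 j (y (m + s)%N)))).
    by apply: ler_sum => j _; have [? ? ? ? []] := wP j.
  rewrite -mulr_sumr ler_wpM2l// exchange_big mulr_sumr; apply: ler_sum => s _ /=.
  rewrite -mulr_sumr mulrCA ler_wpM2l ?exprn_ge0//.
  by apply: rowadj_le => //; apply: wold_fin (hy _).
Qed.

Lemma shifted_sum_le (f : nat -> R) n L s : (forall l, 0 <= f l) -> (s <= L)%N ->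
  \sum_(k < n) f (s + k)%N <= \sum_(l < L + n) f l.
Proof.
move=> f0 sL; have -> : (L + n = s + (n + (L - s)))%N by lia.
rewrite !big_split_ord /= addrCA lerDl addr_ge0// ?sumr_ge0//.
Qed.

(** Each f l is counted, for a given s, at most once, as k runs over the
    degrees. *)
Lemma weighted_shift_le (f : nat -> R) n L S : (forall l, 0 <= f l) ->
  \sum_(l < L + n.+1) f l <= S ->
  \sum_(k < n.+1) \sum_(s < L) `|q| ^+ s * f (n - k + s)%N <= (1 - `|q|)^-1 * S.
Proof.
move=> f0 fS; have S0 : 0 <= S by apply: le_trans fS; exact: sumr_ge0.
rewrite exchange_big /=; apply: (@le_trans _ _ (\sum_(s < L) `|q| ^+ s * S)).
  apply: ler_sum => s _; rewrite -mulr_sumr ler_wpM2l ?exprn_ge0//.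
  apply: le_trans fS; apply: le_trans (shifted_sum_le n.+1 f0 (ltnW (ltn_ord s))).
  rewrite (reindex_inj (@rev_ord_inj n.+1)) /=.
  apply: ler_sum => k _; rewrite subSS subKn; last by rewrite -ltnS.
  by rewrite addnC.
by rewrite -mulr_suml ler_wpM2r// geometric_sum_le.
Qed.

(** The vectors P k are orthogonal by their Wold degrees, so each contributes
    its own square; the vectors Q k are added by Cauchy-Schwarz, which costs
    n + 1, but their squares are summable over k. *)
Lemma haagerup_fin (alpha : seq I -> K) n x : fin x ->
  sqn dot (\sum_(w : n.-tuple I) alpha w *: circ_word w x) <=
  haagerup_const `|q| * n.+1%:R *
    sqn dot (\sum_(w : n.-tuple I) alpha w *: circ_word w Om) * sqn dot x.
Proof.
move=> fx; under [X in _ * sqn dot X * _]eq_bigr => w _ do rewrite circ_word_Om.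
set vec := \sum_(w : n.-tuple I) alpha w *: cre (map i1 w) Om.
have [y hy [L yE]] := wold_decomposition i2 fx.
have sp (k : 'I_n.+1) := degree_split alpha
  (esym (subnKC (ltn_ord k : (k <= n)%N))) fx hy yE.
have [P] := choice sp => /choice[Q PQ] {sp}.
have -> : \sum_(w : n.-tuple I) alpha w *: circ_word w x = \sum_k P k + \sum_k Q k.
  rewrite -big_split /=.
  under eq_bigr => w _ do rewrite circ_word_expand size_tuple scaler_sumr.
  rewrite exchange_big; apply: eq_bigr => k _ /=.
  by have [] := PQ k.
have C0 := C_gt0; have C20 := C2_ge0.
have q1' : 0 < 1 - `|q| by rewrite subr_gt0.
have vx : 0 <= sqn dot vec * sqn dot x by rewrite mulr_ge0 ?sqn_ge0.
apply: le_trans (sqnD_le _ _ _) _.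
have -> : haagerup_const `|q| * n.+1%:R * sqn dot vec * sqn dot x =
  2 * (n.+1%:R * (C ^+ 2 * sqn dot vec * sqn dot x) +
       n.+1%:R * (C ^+ 3 * C2 * sqn dot vec * ((1 - `|q|)^-1 * sqn dot x))).
  by rewrite /haagerup_const; ring.
rewrite ler_pM2l// lerD//.
  rewrite sqn_pythagoras; last first.
    move=> k l kl; have [_ wk _ _] := PQ k; have [_ wl _ _] := PQ l.
    by apply: (wold_orth i1_inj _ wk wl).
  rewrite mulr_natl -[X in _ *+ X](card_ord n.+1) -sumr_const; apply: ler_sum => k _.
  by have [] := PQ k.
apply: le_trans (sqn_sum_le _ _) _; rewrite card_ord ler_wpM2l//.
apply: (@le_trans _ _ (\sum_(k < n.+1) C ^+ 3 * C2 * sqn dot vec *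
      \sum_(s < L) `|q| ^+ s * sqn dot (y (n - k + s)%N))).
  by apply: ler_sum => k _; have [] := PQ k.
rewrite -mulr_sumr ler_wpM2l//.
  by rewrite !mulr_ge0 ?sqn_ge0 ?exprn_ge0 ?invr_ge0 ?ltW// sqr_ge0.
apply: (@weighted_shift_le (fun l => sqn dot (y l))) => [l|]; first exact: sqn_ge0.
rewrite [X in _ <= sqn dot X](yE (L + n.+1)%N) ?leq_addr// sqn_pythagoras//.
by move=> i j ij; apply: (wold_orth i2_inj _ (hy _) (hy _)).
Qed.

End TwoRows.

End Fock.

(** * Annihilation as the adjoint of creation *)

Lemma sum_ltn_ord n (k : 'I_n.+1) : (\sum_(i < n) (i < k)%N)%N = k.
Proof.
transitivity (\sum_(i < n | (i < k)%N) 1)%N.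
  by rewrite [RHS]big_mkcond; apply: eq_bigr => i _; case: ifP.
rewrite -(big_ord_widen n (fun=> 1%N)) ?sum1_card ?card_ord//.
by rewrite -ltnS.
Qed.

Lemma inversionsE n (p : 'S_n) :
  inversions p = (\sum_(i < n) \sum_(j < n) ((i < j) && (p j < p i)))%N.
Proof.
rewrite /inversions -sum1_card.
rewrite (pair_bigA _ (fun i j : 'I_n => ((i < j) && (p j < p i))%N : nat)) /=.
rewrite big_mkcond; apply: eq_bigr => -[i j] _ /=.
rewrite [X in if X then _ else _](_ : _ = ((i < j) && (p j < p i))%N); last first.
  by apply/idP/idP => h; [have := set_mem h|exact: mem_set].
by case: ifP.
Qed.

(** The position k, sent to 0, forms an inversion with each of the k positions
    before it and with no other one. *)
Lemma inversions_lift n (k : 'I_n.+1) (p : 'S_n) :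
  inversions (lift_perm k ord0 p) = (k + inversions p)%N.
Proof.
rewrite !inversionsE (bigD1_ord k)//= [X in (X + _)%N]big1 ?add0n; last first.
  by move=> j _; rewrite lift_perm_id ltn0 andbF.
rewrite -[in RHS](sum_ltn_ord k) -big_split; apply: eq_bigr => i _ /=.
rewrite (bigD1_ord k)//=; congr addn.
  rewrite lift_perm_id lift_perm_lift /= /bump leq0n /= andbT.
  by congr nat_of_bool; case: leqP => ?; lia.
apply: eq_bigr => j _; rewrite !lift_perm_lift /=.
rewrite /bump !leq0n !add1n ltnS; congr (nat_of_bool (_ && _)).
by case: (leqP k i); case: (leqP k j); lia.
Qed.

Lemma sum_lift_perm (V : nmodType) n (G : 'S_n.+1 -> V) :
  \sum_p G p = \sum_(k < n.+1) \sum_(p : 'S_n) G (lift_perm k ord0 p).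
Proof.
rewrite pair_bigA /=; apply: reindex; apply/onW_bij.
apply: inj_card_bij => [[k p] [l r] /= /permP e|]; last first.
  by rewrite card_prod !card_Sn card_ord factS.
have kl : k = l.
  by apply: (@perm_inj _ (lift_perm l ord0 r)); rewrite -e !lift_perm_id.
subst l; congr pair; apply/permP => i.
by have := e (lift k i); rewrite !lift_perm_lift => /lift_inj.
Qed.

Section TensorFacts.
Variables (R : realType) (d : nat) (q : R).
Local Notation K := R[i].
Local Notation J := 'I_(d + d).
Local Notation qc := (q%:C%C : K).
Local Notation vec j := (delta_mx 0 j : oneparticle R d).

Definition tcons n (j : J) (s : multiindex d n) : multiindex d n.+1 :=
  [ffun k => if unlift ord0 k is Some i then s i else j].
Definition tdel n (k : 'I_n.+1) (t : multiindex d n.+1) : multiindex d n :=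
  [ffun i => t (lift k i)].

Lemma tensor_basis n (x : tensor R d n) : x = \sum_t x t *: tbasis R t.
Proof.
apply/ffunP => s; rewrite sum_ffunE (bigD1 s)//= big1 => [|t /negPf ts].
  by rewrite addr0 !ffunE eqxx /GRing.scale /= mulr1.
by rewrite !ffunE eq_sym ts /GRing.scale /= mulr0.
Qed.

Lemma hdot_vec i j : hdot (vec i) (vec j) = (i == j)%:R.
Proof.
rewrite /hdot (bigD1 i)//= big1 => [|k /negPf ki]; last by rewrite mxE ki andbF mul0r.
by rewrite !mxE !eqxx mul1r addr0 rmorph_nat.
Qed.

Lemma creation_tbasis n j (s : multiindex d n) :
  creation (vec j) (tbasis R s) = tbasis R (tcons j s).
Proof.
apply/ffunP => t; rewrite !ffunE mxE eqxx /= -natrM mulnb; congr (_ %:R).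
congr nat_of_bool; apply/andP/eqP => [[/eqP <- /eqP <-]|->].
  apply/ffunP => k; rewrite ffunE; case: (unliftP ord0 k) => [i ->|->] //.
  by rewrite ffunE.
rewrite ffunE unlift_none eqxx; split=> //; apply/eqP/ffunP => k.
by rewrite !ffunE liftK.
Qed.

Lemma annihilation_tbasis n j (t : multiindex d n.+1) :
  annihilation q (vec j) (tbasis R t) =
  \sum_(k < n.+1) (qc ^+ k * (t k == j)%:R) *: tbasis R (tdel k t).
Proof.
rewrite /annihilation (bigD1 t)//= ffunE eqxx scale1r [X in _ + X]big1 ?addr0.
  by apply: eq_bigr => k _; rewrite hdot_vec.
by move=> s /negPf st; rewrite ffunE st scale0r.
Qed.

Lemma tdot_qsym_tbasis n (s t : multiindex d n) :
  tdot (qsym q (tbasis R s)) (tbasis R t) =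
  \sum_(p : 'S_n) qc ^+ inversions p * ([ffun k => s (p k)] == t)%:R.
Proof.
rewrite /tdot (bigD1 t)//= big1 => [|t' /negPf tt']; last first.
  by rewrite [X in _ * X^*]ffunE tt' rmorph0 mulr0.
rewrite [X in _ * X^*]ffunE eqxx rmorph1 mulr1 addr0.
have -> : qsym q (tbasis R s) = \sum_(p : 'S_n) (qc ^+ inversions p) *:
    tbasis R [ffun k => s (p k)].
  rewrite /qsym (bigD1 s)//= ffunE eqxx scale1r [X in _ + X]big1 ?addr0//.
  by move=> s' /negPf ss'; rewrite ffunE ss' scale0r.
rewrite sum_ffunE; apply: eq_bigr => p _; rewrite !ffunE /GRing.scale /=.
by rewrite eq_sym.
Qed.

Lemma tdot_qsym_tcons n j (s : multiindex d n) (t : multiindex d n.+1) :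
  tdot (qsym q (tbasis R (tcons j s))) (tbasis R t) =
  \sum_(k < n.+1) qc ^+ k * (t k == j)%:R *
    tdot (qsym q (tbasis R s)) (tbasis R (tdel k t)).
Proof.
rewrite tdot_qsym_tbasis sum_lift_perm; apply: eq_bigr => k _.
rewrite tdot_qsym_tbasis mulr_sumr; apply: eq_bigr => p _.
rewrite inversions_lift exprD mulrACA -natrM mulnb; congr (_ * _ %:R).
congr nat_of_bool; apply/eqP/andP => [<-|[/eqP tk /eqP st]].
  rewrite !ffunE lift_perm_id unlift_none eqxx; split=> //.
  by apply/eqP/ffunP => i; rewrite !ffunE lift_perm_lift liftK.
apply/ffunP => i; rewrite !ffunE; case: (unliftP k i) => [i' ->|->].
  rewrite lift_perm_lift liftK.
  by have := congr1 (fun f : multiindex d n => f i') st; rewrite !ffunE.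
by rewrite lift_perm_id unlift_none.
Qed.

Lemma tdel_tcons0 n j (t : multiindex d n) : tdel ord0 (tcons j t) = t.
Proof. by apply/ffunP => k; rewrite !ffunE liftK. Qed.

Lemma tdel_tconsS n j (k : 'I_n.+1) (t : multiindex d n.+1) :
  tdel (lift ord0 k) (tcons j t) = tcons j (tdel k t).
Proof.
apply/ffunP => i; rewrite !ffunE; case: (unliftP ord0 i) => [i' ->|->].
  have -> : lift (lift ord0 k) (lift ord0 i') = lift ord0 (lift k i').
    by apply/val_inj; rewrite /= /bump !leq0n !add1n ltnS addnS.
  by rewrite liftK ffunE.
have -> : lift (lift ord0 k) ord0 = ord0 by apply/val_inj.
by rewrite unlift_none.
Qed.

End TensorFacts.

(** * Passage to the completed Fock space *)

Section FockModel.
Variables (R : realType) (d : nat) (q : R) (F : qFockSpace d q).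
Local Notation K := R[i].
Local Notation J := 'I_(d + d).
Local Notation qc := (q%:C%C : K).
Local Notation vec j := (delta_mx 0 j : oneparticle R d).

Lemma fdot_linear c (x y z : F) :
  fock_dot F (c *: x + y) z = c * fock_dot F x z + fock_dot F y z.
Proof. by rewrite linearPl. Qed.

Lemma fdot_sym (x y : F) : fock_dot F y x = (fock_dot F x y)^*.
Proof. by rewrite hermC expr0 mul1r. Qed.

Lemma fdot_ge0 (x : F) : 0 <= fock_dot F x x.
Proof. by have := exprn_ge0 2 (normr_ge0 x); rewrite fock_norm. Qed.

Definition fdot : psd_form F := PsdForm fdot_linear fdot_sym fdot_ge0.

Lemma fdot_norm (x : F) : fdot x x = `|x| ^+ 2.
Proof. by rewrite fock_norm. Qed.

Lemma fdot_in n (x y : tensor R d n) :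
  fdot (fock_in F n x) (fock_in F n y) = tdot (qsym q x) y.
Proof. exact: fock_in_dot. Qed.

Lemma fdot_orth m n (x : tensor R d m) (y : tensor R d n) : m <> n ->
  fdot (fock_in F m x) (fock_in F n y) = 0.
Proof. exact: fock_in_orthogonal. Qed.

Lemma fnrm (x : F) : nrm fdot x = complex.Re `|x|.
Proof.
have x0 : 0 <= complex.Re `|x| :> R.
  by rewrite -ler0c RRe_real ?normr_real.
rewrite /nrm -[RHS](ger0_norm x0) -sqrtr_sqr; congr Num.sqrt.
by rewrite /sqn fdot_norm -[in LHS](RRe_real (normr_real x)) -rmorphXn.
Qed.

Lemma normE (x : F) : `|x| = (nrm fdot x)%:C%C.
Proof. by rewrite fnrm RRe_real ?normr_real. Qed.

Lemma fdot_definite (x : F) : sqn fdot x = 0 -> x = 0.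
Proof.
by move=> x0; apply/eqP; rewrite -normr_eq0 normE /nrm x0 sqrtr0.
Qed.

Variables (a astar : oneparticle R d -> {linear F -> F}).
Hypothesis aP : forall u, is_creation u (a u).
Hypothesis astarP : forall u, is_annihilation u (astar u).
Local Notation ca := (fun j => a (vec j)).
Local Notation an := (fun j => astar (vec j)).
Local Notation Om := (fock_in F 0 (vacuum R d)).

Lemma an_Om j : an j Om = 0.
Proof. by have [_ -> _] := astarP (vec j). Qed.

Lemma tbasis0 (t : multiindex d 0) : tbasis R t = vacuum R d.
Proof.
apply/ffunP => s; rewrite !ffunE (_ : s = t) ?eqxx//.
by apply/ffunP => -[].
Qed.

Lemma tcons_tdel n (t : multiindex d n.+1) : t = tcons (t ord0) (tdel ord0 t).
Proof.
apply/ffunP => k; rewrite ffunE; case: (unliftP ord0 k) => [i ->|->] //.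
by rewrite ffunE.
Qed.

Lemma ca_tbasis n j (t : multiindex d n) :
  ca j (fock_in F n (tbasis R t)) = fock_in F n.+1 (tbasis R (tcons j t)).
Proof. by have [_ ->] := aP (vec j); rewrite creation_tbasis. Qed.

Lemma an_tbasis n j (t : multiindex d n.+1) :
  an j (fock_in F n.+1 (tbasis R t)) = \sum_(k < n.+1) (qc ^+ k * (t k == j)%:R) *:
     fock_in F n (tbasis R (tdel k t)).
Proof.
have [_ _ ->] := astarP (vec j); rewrite annihilation_tbasis linear_sum.
by apply: eq_bigr => k _; rewrite linearZ.
Qed.

Lemma fock_word n (t : multiindex d n) :
  fock_in F n (tbasis R t) = cre ca [seq t i | i <- enum 'I_n] Om.
Proof.
elim: n t => [|n IH] t.
  by rewrite tbasis0 (size0nil (_ : size (enum 'I_0) = 0%N)) ?size_enum_ord.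
rewrite {1}(tcons_tdel t) -ca_tbasis IH enum_ordSl /=; congr (a _ (cre _ _ _)).
by rewrite -map_comp; apply: eq_map => i; rewrite ffunE.
Qed.

Lemma dot_Om : fdot Om Om = 1.
Proof.
pose t0 : multiindex d 0 := ffun0 (card_ord 0).
rewrite -(tbasis0 t0) fdot_in tdot_qsym_tbasis (bigD1 1%g)//= big1 => [|p].
  rewrite inversionsE big_ord0 expr0 mul1r addr0 (_ : _ == t0)//.
  by apply/eqP/ffunP => -[].
by case/eqP; apply/permP => -[].
Qed.

Lemma fock_basis n (x : tensor R d n) :
  fock_in F n x = \sum_t x t *: fock_in F n (tbasis R t).
Proof.
rewrite {1}[x]tensor_basis linear_sum; apply: eq_bigr => t _.
by rewrite linearZ.
Qed.

Lemma homog_fock n (x : tensor R d n) : homog ca Om n (fock_in F n x).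
Proof.
rewrite [x]tensor_basis linear_sum; apply: homog_sum => t _; rewrite linearZ.
by apply/homogZ; rewrite fock_word; apply: homog_word; rewrite size_map size_enum_ord.
Qed.

Definition algebraic (x : F) :=
  exists N (f : forall n, tensor R d n), x = \sum_(n < N) fock_in F n (f n).

Lemma algebraic_fin x : algebraic x -> fin ca Om x.
Proof.
by move=> [N [f ->]]; apply: fin_sum => n _; apply: fin_homog (homog_fock _).
Qed.

Lemma algebraic_dense (x : F) (P : set F) : nbhs x P -> exists2 y, algebraic y & P y.
Proof.
move=> xP; have [y [Py Dy]] := @fock_in_dense _ _ _ F (interior P)
  (ex_intro _ x xP) (@open_interior _ P).
by exists y => //; exact: interior_subset.
Qed.

Lemma nbhs_norm (V : normedModType K) (x : V) (e : R) : 0 < e ->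
  nbhs x [set y : V | `|x - y| < e%:C%C]%classic.
Proof.
move=> e0; have : nbhs x (ball x e%:C%C) by apply: nbhsx_ballx; rewrite ltcR.
by rewrite -ball_normE.
Qed.

Lemma continuous_dense_eq (V : normedModType K) (f g : F -> V) :
  continuous f -> continuous g ->
  (forall y, algebraic y -> f y = g y) -> forall x, f x = g x.
Proof.
move=> fc gc fg x; apply/eqP; rewrite -subr_eq0; apply: contraT => fgx.
have fgx0 : `|f x - g x| = (complex.Re `|f x - g x|)%:C%C.
  by rewrite RRe_real ?normr_real.
set e := complex.Re _ in fgx0.
have e0 : 0 < e / 2 by rewrite divr_gt0// -ltcR -fgx0 normr_gt0.
have fx : nbhs x (f @^-1` [set z | `|f x - z| < (e / 2)%:C%C])%classic.
  exact: fc (nbhs_norm _ e0).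
have gx : nbhs x (g @^-1` [set z | `|g x - z| < (e / 2)%:C%C])%classic.
  exact: gc (nbhs_norm _ e0).
have [y /fg fgy [fy gy]] := algebraic_dense (filterI fx gx).
have : `|f x - g x| < (e / 2)%:C%C + (e / 2)%:C%C.
  have -> : f x - g x = (f x - f y) - (g x - g y) by rewrite fgy opprB addrA subrK.
  by apply: le_lt_trans (ler_normB _ _) _; exact: ltrD.
by rewrite -rmorphD /= -splitr fgx0 ltxx.
Qed.

Lemma lipschitz_continuous (f : F -> K) (M : R) : 0 <= M ->
  (forall x z, cabs (f x - f z) <= M * nrm fdot (x - z)) ->
  continuous (f : F -> K^o).
Proof.
move=> M0 fM x; apply/cvgrPdist_lt => e e0.
have er : e = (complex.Re e)%:C%C by rewrite RRe_real// ger0_real// ltW.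
have M1 : 0 < M + 1 by rewrite ltr_wpDl.
have e0' : 0 < complex.Re e / (M + 1) by rewrite divr_gt0// -ltcR -er.
apply: filterS (nbhs_norm x e0') => z /=.
rewrite normE ltcR ltr_pdivlMr// => xz.
change (`|f x - f z : K| < e); rewrite -cabsE er ltcR.
apply: le_lt_trans (fM x z) _; apply: le_lt_trans xz.
by rewrite mulrC ler_wpM2l ?nrm_ge0// lerDl.
Qed.

Lemma fdot_cont_l y : continuous (fun x : F => fdot x y : K^o).
Proof.
apply: (@lipschitz_continuous (fdot^~ y) (nrm fdot y) (nrm_ge0 _ _)) => x z.
by rewrite -psdNl -psdDl mulrC psd_CS_nrm.
Qed.

Lemma fdot_cont_r y : continuous (fun x : F => fdot y x : K^o).
Proof.
apply: (@lipschitz_continuous (fdot y) (nrm fdot y) (nrm_ge0 _ _)) => x z.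
by rewrite -psdNr -psdDr psd_CS_nrm.
Qed.

Lemma ca_cont j : continuous (ca j). Proof. by have [] := aP (vec j). Qed.
Lemma an_cont j : continuous (an j). Proof. by have [] := astarP (vec j). Qed.

Lemma ca_an_adj_hom j n m (x : tensor R d n) (y : tensor R d m) :
  fdot (ca j (fock_in F n x)) (fock_in F m y) =
  fdot (fock_in F n x) (an j (fock_in F m y)).
Proof.
rewrite !fock_basis; set X := fun s => fock_in F n (tbasis R s).
set Y := fun t => fock_in F m (tbasis R t).
transitivity (\sum_s \sum_t x s * (y t)^* * fdot (ca j (X s)) (Y t)).
  rewrite linear_sum psd_suml; apply: eq_bigr => s _; rewrite psd_sumr.
  by apply: eq_bigr => t _; rewrite linearZ /= psdZl psdZr mulrA.
rewrite linear_sum psd_suml; apply: eq_bigr => s _; rewrite psd_sumr.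
apply: eq_bigr => t _; rewrite linearZ /= psdZl psdZr mulrA; congr (_ * _).
rewrite /X /Y {X Y} ca_tbasis; case: m y t => [|m] y t.
  by have [_ -> _] := astarP (vec j); rewrite psd0r fdot_orth.
have [nm|/eqP nm] := eqVneq n m; last first.
  rewrite fdot_orth; last by case.
  have [_ _ ->] := astarP (vec j); by rewrite fdot_orth.
subst m; rewrite fdot_in an_tbasis psd_sumr tdot_qsym_tcons.
apply: eq_bigr => k _; rewrite psdZr fdot_in; congr (_ * _).
by rewrite rmorphM /= rmorph_nat -rmorphXn conj_real.
Qed.

(** The identity on algebraic vectors is extended in one variable at a time,
    by continuity. *)
Lemma ca_an_adj j x y : fdot (ca j x) y = fdot x (an j y).
Proof.
move: y; apply: (@continuous_dense_eq K^o (fun y => fdot (ca j x) y : K^o)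
  (fun y => fdot x (an j y) : K^o)).
- exact: fdot_cont_r.
- move=> y; apply: (@continuous_comp _ _ _ (an j) (fun y => fdot x y : K^o)).
    exact: an_cont.
  exact: fdot_cont_r.
move=> y algy; move: x.
apply: (@continuous_dense_eq K^o (fun x => fdot (ca j x) y : K^o)
  (fun x => fdot x (an j y) : K^o)).
- move=> x; apply: (@continuous_comp _ _ _ (ca j) (fun x => fdot x y : K^o)).
    exact: ca_cont.
  exact: fdot_cont_l.
- exact: fdot_cont_l.
move=> x [N [f ->]]; case: algy => [M [g ->]].
rewrite !linear_sum !psd_suml; apply: eq_bigr => n _.
by rewrite !psd_sumr; apply: eq_bigr => m _; exact: ca_an_adj_hom.
Qed.

(** On a basis tensor, the annihilation of the letter just created gives the
    constant term, and the positions of the other letters are shifted by one,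
    which gives the factor q. *)
Lemma an_ca_comm i j x : an i (ca j x) =
  qc *: ca j (an i x) + (if i == j then x else 0).
Proof.
have -> : (if i == j then x else 0) = (i == j)%:R *: x.
  by case: eqP; rewrite ?scale1r ?scale0r.
move: x; apply: continuous_dense_eq.
- move=> x; apply: (@continuous_comp _ _ _ (ca j) (an i)).
    exact: ca_cont.
  exact: an_cont.
- move=> x; apply: (@continuousD _ _ _ (fun x => qc *: ca j (an i x))
    (fun x => (i == j)%:R *: x)).
    apply: cvgZl_tmp; apply: (@continuous_comp _ _ _ (an i) (ca j)).
      exact: an_cont.
    exact: ca_cont.
  exact: cvgZl_tmp.
move=> x [N [f ->]].
have anca (T : finType) (z : T -> F) (c : T -> K) :
    (forall t, an i (ca j (z t)) = qc *: ca j (an i (z t)) + (i == j)%:R *: z t) ->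
    an i (ca j (\sum_t c t *: z t)) = qc *: ca j (an i (\sum_t c t *: z t)) +
      (i == j)%:R *: (\sum_t c t *: z t).
  move=> hz; rewrite (linear_sum (a (vec j))) (linear_sum (astar (vec i))) /=.
  rewrite (linear_sum (astar (vec i))) (linear_sum (a (vec j))) !scaler_sumr -big_split.
  apply: eq_bigr => t _ /=.
  have aZ u k w : a u (k *: w) = k *: a u w by exact: linearZ.
  have asZ u k w : astar u (k *: w) = k *: astar u w by exact: linearZ.
  rewrite !aZ !asZ hz !aZ scalerDr.
  by congr (_ + _); rewrite !scalerA mulrC.
have -> : \sum_(n < N) fock_in F n (f n) = \sum_(n < N) 1 *: fock_in F n (f n).
  by apply: eq_bigr => n _; rewrite scale1r.
apply: (@anca) => n; rewrite fock_basis; apply: (@anca) => t.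
rewrite ca_tbasis an_tbasis big_ord_recl expr0 mul1r.
rewrite {1}/tcons ffunE unlift_none tdel_tcons0 [j == i]eq_sym addrC; congr (_ + _).
case: (n : nat) t => [|n'] t.
  by rewrite big_ord0 tbasis0 an_Om !linear0.
rewrite an_tbasis linear_sum scaler_sumr; apply: eq_bigr => k _.
rewrite linearZ /= ca_tbasis tdel_tconsS scalerA mulrA -exprS.
by rewrite [tcons j t _]ffunE liftK.
Qed.


Lemma word_op_circ (w : seq 'I_d) x :
  word_op (circular a astar) w x = circ_word ca an (lshift d) (@rshift d d) w x.
Proof. by elim: w => //= i w <-. Qed.

Lemma word_op_continuous (w : seq 'I_d) : continuous (word_op (circular a astar) w).
Proof.
elim: w => [|i w IH] x; first exact: cvg_id.
apply: (@continuous_comp _ _ _ (word_op (circular a astar) w) (circular a astar i)).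
  exact: IH.
apply: (@continuousD _ _ _ (a (e_vec R i)) (astar (ebar_vec R i))).
  exact: ca_cont.
exact: an_cont.
Qed.

Lemma hom_poly_continuous (alpha : seq 'I_d -> K) n :
  continuous (hom_poly (circular a astar) alpha n).
Proof.
rewrite /hom_poly; elim: (index_enum _) => [|w s IH] x.
  rewrite (_ : (fun x => _) = fun=> 0); first exact: cvg_cst.
  by apply/funext => z; rewrite big_nil.
rewrite (_ : (fun x => _) = (fun z => alpha w *: word_op (circular a astar) w z) \+
    (fun z => \sum_(w <- s) alpha w *: word_op (circular a astar) w z)).
  apply: continuousD; last exact: IH.
  by apply: cvgZl_tmp; exact: (@word_op_continuous w x).
by apply/funext => z; rewrite big_cons.
Qed.

Hypothesis q1 : `|q| < 1.

Lemma haagerup_algebraic (alpha : seq 'I_d -> K) n x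
    (T := hom_poly (circular a astar) alpha n) : algebraic x ->
  nrm fdot (T x) <= Num.sqrt (haagerup_const `|q|) * Num.sqrt n.+1%:R *
    norm2 T * nrm fdot x.
Proof.
move=> algx; have fx := algebraic_fin algx.
have TE y : T y = \sum_(w : n.-tuple 'I_d) alpha w *:
    circ_word ca an (lshift d) (@rshift d d) w y.
  by apply: eq_bigr => w _; rewrite word_op_circ.
have lr i j : lshift d i != rshift d j by rewrite eq_lrshift.
have := haagerup_fin q1 fdot_definite ca_an_adj an_ca_comm an_Om dot_Om
  (@lshift_inj d d) (@rshift_inj d d) lr alpha n fx.
rewrite -!TE /norm2 -fnrm => h.
have c0 : 0 <= haagerup_const `|q| by rewrite ltW// haagerup_const_gt0.
have n0 : 0 <= n.+1%:R :> R by [].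
apply: le_trans (ler_wsqrtr h) _.
rewrite sqrtrM; last by apply: mulr_ge0; [exact: mulr_ge0|exact: sqn_ge0].
rewrite sqrtrM; last exact: mulr_ge0.
by rewrite sqrtrM.
Qed.

(** If the bound failed at x, it would fail at all vectors y near x, by
    continuity of T, and some of them are algebraic. *)
Lemma haagerup_norm (alpha : seq 'I_d -> K) n x
    (T := hom_poly (circular a astar) alpha n) :
  nrm fdot (T x) <= Num.sqrt (haagerup_const `|q|) * Num.sqrt n.+1%:R *
    norm2 T * nrm fdot x.
Proof.
set B := _ * _ * norm2 T.
have B0 : 0 <= B.
  by rewrite !mulr_ge0 ?sqrtr_ge0// /norm2 -fnrm nrm_ge0.
rewrite leNgt; apply/negP => h.
have e0 : 0 < (nrm fdot (T x) - B * nrm fdot x) / (B + 1).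
  by rewrite divr_gt0 ?subr_gt0// ltr_wpDl.
set e := _ / _ in e0.
have Tx : nbhs x (T @^-1` [set z | `|T x - z| < e%:C%C])%classic.
  exact: (@hom_poly_continuous alpha n x) (nbhs_norm _ e0).
have [y algy [/= xy Txy]] := algebraic_dense (filterI (nbhs_norm x e0) Tx).
move: xy Txy; rewrite !normE !ltcR => xy Txy.
have hy := haagerup_algebraic alpha n algy; rewrite -/T -/B in hy.
have h1 : nrm fdot (T x) <= nrm fdot (T x - T y) + nrm fdot (T y).
  by rewrite -{1}(subrK (T y) (T x)) nrmD.
have h2 : nrm fdot y <= nrm fdot (x - y) + nrm fdot x.
  rewrite -{1}(subKr x y) (le_trans (nrmD _ _ _))// addrC lerD2r.
  by rewrite /nrm /sqn psdNl psdNr opprK.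
have h3 : e * (B + 1) = nrm fdot (T x) - B * nrm fdot x.
  by rewrite /e divfK// gt_eqF// ltr_wpDl.
have h4 : B * nrm fdot y <= B * (nrm fdot (x - y) + nrm fdot x) by rewrite ler_wpM2l.
have h5 : B * nrm fdot (x - y) <= B * e by rewrite ler_wpM2l// ltW.
by move: h1 hy h3 h4 h5 Txy; rewrite !mulrDr mulr1; lra.
Qed.

End FockModel.

Theorem theorem1p2 (R : realType) :
  exists A : R -> R, forall q : R, -1 < q < 1 ->
    0 < A `|q| /\
    forall (d : nat) (F : qFockSpace d q)
      (a astar : oneparticle R d -> {linear F -> F}),
      (forall u, is_creation u (a u)) ->
      (forall u, is_annihilation u (astar u)) ->
      forall (n : nat) (alpha : seq 'I_d -> R[i]),
        let T := hom_poly (circular a astar) alpha n in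
        (opnorm T <= (A `|q| * Num.sqrt n.+1%:R * norm2 T)%:E)%E.
Proof.
exists (fun r => Num.sqrt (haagerup_const r)) => q; rewrite -ltr_norml => q1.
split; first by rewrite sqrtr_gt0 haagerup_const_gt0.
move=> d F a astar aP astarP n alpha; lazy zeta.
apply: ub_ereal_sup => _ [x /= x1 <-]; rewrite lee_fin -fnrm.
apply: le_trans (haagerup_norm aP astarP q1 alpha n x) _.
rewrite ler_piMr//; first by rewrite !mulr_ge0 ?sqrtr_ge0// /norm2 -fnrm nrm_ge0.
by rewrite -lecR -normE.
Qed.
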